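(* Assume $n\ge 2$ and $d\ge 5$ and set $x=1+\lceil nd/2\rceil$. Fix a reducible rational normal curve $T=T_1\cup\cdots\cup T_s\subset\mathbb{P}^n$, $s\ge 2$, where $T_1,\dots,T_s$ are the irreducible components of $T$. Assume the existence of $S\in\mathbb{T}(n,d;x)'$ such that $S\subset T$. Set $n_i:=\deg(T_i)$ and $x_i:=\#(S\cap T_i)$. Then: (i) $S\subset T_{\mathrm{reg}}$, where $T_{\mathrm{reg}}$ is the smooth locus of $T$; (ii) $n$ is even and $d$ is odd; (iii) every final component $T_i$ of $T$ has $n_i$ odd and $2x_i=n_id+1$.
   Context: We work over an algebraically closed field of characteristic $0$. For a finite set $S\subset\mathbb{P}^n$, $\langle S\rangle$ is its linear span, and $2S\subset\mathbb{P}^n$ is the zero-dimensional scheme defined by the ideal sheaf $(\mathcal{I}_S)^2$ (the union of the double points supported at $S$). For a closed subscheme $Z\subset\mathbb{P}^n$, $h^i(\mathcal{I}_Z(d))=\dim H^i(\mathbb{P}^n,\mathcal{I}_Z(d))$. $\mathbb{T}(n,d;x)$ is the set of all subsets $S\subset\mathbb{P}^n$ of cardinality $x$ such that $h^0(\mathcal{I}_{2S}(d))>0$, $h^1(\mathcal{I}_{2S}(d))>0$ and $\langle S\rangle=\mathbb{P}^n$. $\mathbb{T}(n,d;x)'$ (the minimally Terracini sets) is the set of all $S\in\mathbb{T}(n,d;x)$ such that $h^1(\mathcal{I}_{2A}(d))=0$ for all $A\subsetneq S$. A reducible rational normal curve in $\mathbb{P}^n$ ($n\ge 2$) is a reduced,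 connected and reducible curve $T\subset\mathbb{P}^n$ such that $\deg(T)=n$ and $\langle T\rangle=\mathbb{P}^n$. An irreducible component $T_i$ of $T$ is called a final component if $\#(T_i\cap\mathrm{Sing}(T))=1$. *)

(* Defs.v *)
From HB Require Import structures.
From mathcomp Require Import all_boot all_order all_algebra.
From mathcomp Require Import finmap boolp classical_sets mpoly.

Set Implicit Arguments.
Unset Strict Implicit.
Unset Printing Implicit Defensive.

Import GRing.Theory.
Local Open Scope ring_scope.
Local Open Scope classical_set_scope.

(* dim (Z / B) >= m, for a K-vector space V with scalar multiplication sc;
   Z / B may be infinite dimensional. *)
Definition quot_dim_ge (K : closedFieldType) (V : zmodType) (sc : K -> V -> V)
    (Z B : set V) (m : nat) : Prop :=
  exists v : 'I_m -> V,
    (forall i, Z (v i)) /\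
    (forall a : 'I_m -> K, B (\sum_i sc (a i) (v i)) -> forall i, a i = 0).

Section ProjectiveSpace.
Variables (K : closedFieldType) (n : nat).

(* Points of P^n are the lines through the origin in K^(n+1). *)
Definition pspace := {U : {vspace 'rV[K]_n.+1} | \dim U == 1%N}.
HB.instance Definition _ := SubChoice.on pspace.

Local Notation R := {mpoly K[n.+1]}.
Local Notation FR := {fraction R}.
Local Notation tofrac := (@FracField.tofrac R).

(* All vectors of the line are used, so that F need not be homogeneous: since K
   is infinite this amounts to the vanishing of every homogeneous part of F. *)
Definition vanishes_at (F : R) (P : pspace) : Prop :=
  forall u : 'rV[K]_n.+1, u \in val P -> F.@[u 0] = 0.

Definition vanishing_ideal (A : set pspace) : set R :=
  [set F | forall P, A P -> vanishes_at F P].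

Definition zero_locus (E : set R) : set pspace :=
  [set P | forall F, E F -> vanishes_at F P].

Definition zariski_closed (A : set pspace) : Prop :=
  exists E : set R,
    (forall F, E F -> exists k : nat, F \is k.-homog) /\ A = zero_locus E.

(* <A> = P^n: the only linear subspace containing A is the whole space. *)
Definition spans (A : set pspace) : Prop :=
  forall U : {vspace 'rV[K]_n.+1},
    (forall P, A P -> (val P <= U)%VS) -> U = fullv.

Definition ideal_square (J : set R) : set R :=
  [set F | exists s : seq (R * R),
     (forall p, p \in s -> J p.1 /\ J p.2) /\ F = \sum_(p <- s) p.1 * p.2].

(* For a homogeneous ideal J with associated sheaf J~, the cohomology of J~(d) is
   that of the Cech complex of the cover of P^n by the open sets x_i <> 0, inside
   the fraction field.  On the locus where the product x_t of the variables in t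
   is nonzero, the sections of J~(d) are the quotients F / x_t^N with F in J
   homogeneous of degree d + N * deg x_t.  Cochains are indexed by all tuples,
   without alternation. *)
Definition xprod (p : nat) (t : p.-tuple 'I_n.+1) : R := \prod_(k < p) 'X_(tnth t k).

Definition sheaf_sections (J : set R) (d p : nat) (t : p.-tuple 'I_n.+1) : set FR :=
  [set f | exists (N : nat) (F : R),
     [/\ J F, F \is (d + N * p).-homog & f = tofrac F / tofrac (xprod t) ^+ N]].

Local Notation cochain p := {ffun p.+1.-tuple 'I_n.+1 -> FR}.

Definition cochain_scale (p : nat) (a : K) (c : cochain p) : cochain p :=
  [ffun t => tofrac (a%:MP : R) * c t].

Definition sheaf_cochains (J : set R) (d p : nat) : set (cochain p) :=
  [set c | forall t, sheaf_sections J d t (c t)].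

Definition cech_diff (p : nat) (c : cochain p) : cochain p.+1 :=
  [ffun t : p.+2.-tuple 'I_n.+1 =>
     \sum_(k < p.+2) (-1) ^+ k * c [tuple tnth t (lift k j) | j < p.+1]].

Definition cocycles (J : set R) (d p : nat) : set (cochain p) :=
  [set c | sheaf_cochains J d c /\ cech_diff c = 0].

Definition coboundaries (J : set R) (d p : nat) : set (cochain p) :=
  match p return set (cochain p) with
  | 0 => [set 0]
  | q.+1 => [set c | exists2 b : cochain q, sheaf_cochains J d b & c = cech_diff b]
  end.

(* h^p(P^n, J~(d)) >= m *)
Definition cohom_dim_ge (p : nat) (J : set R) (d m : nat) : Prop :=
  quot_dim_ge (@cochain_scale p) (@cocycles J d p) (@coboundaries J d p) m.

(* The ideal (I_S)^2, whose sheaf is the ideal sheaf of 2S. *)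
Definition double_ideal (S : {fset pspace}) : set R :=
  ideal_square (vanishing_ideal [set` S]).

Definition terracini (d x : nat) (S : {fset pspace}) : Prop :=
  [/\ #|` S| = x,
      cohom_dim_ge 0 (double_ideal S) d 1,
      cohom_dim_ge 1 (double_ideal S) d 1
    & spans [set` S]].

Definition minimally_terracini (d x : nat) (S : {fset pspace}) : Prop :=
  terracini d x S /\
  forall A : {fset pspace}, (A `<` S)%fset ->
    ~ cohom_dim_ge 1 (double_ideal A) d 1.

Definition zariski_irreducible (A : set pspace) : Prop :=
  A !=set0 /\
  forall Z1 Z2, zariski_closed Z1 -> zariski_closed Z2 ->
    A `<=` Z1 `|` Z2 -> A `<=` Z1 \/ A `<=` Z2.

Definition zariski_connected (A : set pspace) : Prop :=
  A !=set0 /\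
  forall Z1 Z2, zariski_closed Z1 -> zariski_closed Z2 ->
    A `<=` Z1 `|` Z2 -> A `&` Z1 `&` Z2 = set0 -> A `<=` Z1 \/ A `<=` Z2.

Definition irreducible_component (A C : set pspace) : Prop :=
  [/\ zariski_irreducible C, C `<=` A
    & forall C', zariski_irreducible C' -> C' `<=` A -> C `<=` C' -> C' = C].

(* A (closed) contains a chain Z_0 < ... < Z_r of irreducible closed sets. *)
Definition has_chain (A : set pspace) (r : nat) : Prop :=
  exists Z : nat -> set pspace,
    (forall k, (k <= r)%N ->
       [/\ zariski_closed (Z k), zariski_irreducible (Z k) & Z k `<=` A]) /\
    (forall k, (k < r)%N -> Z k `<` Z k.+1).

Definition krull_dim (A : set pspace) (r : nat) : Prop :=
  has_chain A r /\ ~ has_chain A r.+1.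

(* Reduced curves, as closed sets of pure dimension 1. *)
Definition reduced_curve (T : set pspace) : Prop :=
  zariski_closed T /\ forall C, irreducible_component T C -> krull_dim C 1.

(* dim (K[x_0..x_n] / I(A))_t = m *)
Definition hilbert_value (A : set pspace) (t m : nat) : Prop :=
  let ge := quot_dim_ge (fun (a : K) (F : R) => a *: F)
              [set F : R | F \is t.-homog] (vanishing_ideal A) in
  ge m /\ ~ ge m.+1.

(* The leading coefficient e of the Hilbert polynomial e * t + c of a curve; only
   meaningful when the Hilbert polynomial has degree 1. *)
Definition curve_degree (A : set pspace) : nat :=
  xget 0%N [set e : nat | exists (c : int) (t0 : nat),
    forall t : nat, (t0 <= t)%N ->
      exists2 m : nat, hilbert_value A t m & m%:Z = e%:Z * t%:Z + c].

(* Jacobian criterion: the tangent space at P to the affine cone over the curve T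
   has dimension 2. *)
Definition smooth_locus (T : set pspace) : set pspace :=
  [set P | T P /\
     exists W : {vspace 'rV[K]_n.+1}, \dim W = 2%N /\
       forall v : 'rV[K]_n.+1, v \in W <->
         (forall (F : R) (u : 'rV[K]_n.+1),
            vanishing_ideal T F -> u \in val P -> u != 0 ->
            \sum_(i < n.+1) (F^`M(i)).@[u 0] * v 0 i = 0)].

Definition singular_locus (T : set pspace) : set pspace := T `\` smooth_locus T.

Definition reducible_rnc (T : set pspace) : Prop :=
  [/\ reduced_curve T, zariski_connected T, ~ zariski_irreducible T,
      curve_degree T = n & spans T].

(* T_1, ..., T_s are the irreducible components of T, without repetition. *)
Definition components_are (T : set pspace) (s : nat) (Tc : 'I_s -> set pspace) : Prop :=
  injective Tc /\
  forall C, irreducible_component T C <-> exists i, C = Tc i.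

Definition final_component (T C : set pspace) : Prop :=
  irreducible_component T C /\ exists! P, (C `&` singular_locus T) P.

Definition card_on (S : {fset pspace}) (A : set pspace) : nat :=
  #|` [fset P in S | `[< A P >]]%fset|.

End ProjectiveSpace.

(* Main.v *)
Require Import Defs.
From HB Require Import structures.
From mathcomp Require Import all_boot all_order all_algebra.
From mathcomp Require Import finmap boolp classical_sets mpoly.
From mathcomp Require Import ring zify.

Set Implicit Arguments.
Unset Strict Implicit.
Unset Printing Implicit Defensive.

Import GRing.Theory.
Local Open Scope ring_scope.
Local Open Scope classical_set_scope.

(** The proof compares two counts of conditions on forms of degree d.

    A union T' of components of T that can be built by gluing on one component
    after the other, each meeting what is already there, has degree n' equal to
    the sum of the degrees, spans a space of dimension at most n', and its
    Hilbert function is at most n' d + 1.  If T' is not all of T, its span is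
    proper, so the set A of points of S on T' is a proper subset of S, and by
    minimality the double points at A impose independent conditions on forms of
    degree d.  As T' has a tangent line at every point of A, at least 2 #A of
    these conditions are conditions on forms restricted to T'; hence
    2 #A <= n' d + 1 ([card_trace]).  For two such unions T' and T'' that cover
    T without common component, summing gives 2 #S <= n d + 2, with strict
    inequality if S meets the intersection of T' and T'', while
    #S = 1 + ceil(n d / 2) forces 2 #S >= n d + 2.  So all these inequalities
    are equalities: n d is even, 2 #A = n' d + 1 on either side, n', n'' and d
    are odd, and no point of S lies on both T' and T'' ([terracini_split]).

    Any two components that meet are separated by such a decomposition
    ([connected_split]); so S avoids the points lying on two components, and the
    parities follow.  A final component and the union of the others form such a
    decomposition too ([connected_complement]).

    What has to be known of T is that its components C are rational normal
    curves in their spans.  If C spans a space of dimension r, hyperplanes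
    through r points of C show that its Hilbert function is at least r t + 1
    ([hilb_lower]).  Forms that vanish on all components but one show that
    these functions add up to at most n t + O(1), so the dimensions r add up to
    at most n; as T is connected and spans, they add up to exactly n
    ([sum_rk]).  Then each Hilbert function is at most r t + O(1), which is enough for
    Bezout's inequality ([slope_bound], [hilb_points]) and gives r t + 1 exactly
    ([hilb_exact]).  The equality of dimensions also makes the spans of two
    components that meet intersect in a single point ([linspan_adjacent]).
    Hence a point on two components is singular, since the tangent space
    contains those of both components, while a point on only one component is
    smooth, by Bezout's inequality for a hyperplane tangent at that point
    ([singular_meet], [smooth_of_unique]).

    The vanishing of h^1 enters through the Cech complex: prescribed first-order
    behaviour at the points of A is realized by local sections over the
    standard open sets, whose differences form a cocycle of the ideal sheaf of
    the double points; writing it as a coboundary corrects the local sections to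
    a global form ([double_jet_lift]). *)

(** * Forms, differentials and points *)

Section Polynomials.
Variables (K : closedFieldType) (n : nat).
Local Notation R := {mpoly K[n.+1]}.
Local Notation vec := 'rV[K]_n.+1.
Local Notation psp := (pspace K n).
Implicit Types (F G : R) (u v w : vec) (P Q : psp) (A B : set psp).

Definition mdiff F u v : K := \sum_(i < n.+1) (F^`M(i)).@[u 0] * v 0 i.

Definition linform (a : vec) : R := \sum_i a 0 i *: 'X_i.

Lemma mdiffD F G u v : mdiff (F + G) u v = mdiff F u v + mdiff G u v.
Proof.
by rewrite -big_split; apply: eq_bigr => i _; rewrite mderivD mevalD mulrDl.
Qed.

Lemma mdiff0 u v : mdiff 0 u v = 0.
Proof. by apply: big1 => i _; rewrite mderiv0 meval0 mul0r. Qed.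

Lemma mdiffZ a F u v : mdiff (a *: F) u v = a * mdiff F u v.
Proof.
by rewrite mulr_sumr; apply: eq_bigr => i _; rewrite mderivZ mevalZ mulrA.
Qed.

Lemma mdiffM F G u v :
  mdiff (F * G) u v = mdiff F u v * G.@[u 0] + F.@[u 0] * mdiff G u v.
Proof.
rewrite mulr_suml mulr_sumr -big_split; apply: eq_bigr => i _ /=.
by rewrite mderivM mevalD !mevalM; ring.
Qed.

Lemma mdiff_sum (I : Type) (s : seq I) (p : pred I) (F : I -> R) u v :
  mdiff (\sum_(i <- s | p i) F i) u v = \sum_(i <- s | p i) mdiff (F i) u v.
Proof.
by elim/big_rec2: _ => [|i y x _ <-]; rewrite ?mdiff0 // mdiffD.
Qed.

Lemma mdiff_addr F u v w : mdiff F u (v + w) = mdiff F u v + mdiff F u w.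
Proof. by rewrite -big_split; apply: eq_bigr => i _; rewrite mxE mulrDr. Qed.

Lemma mdiff_scaler F u a v : mdiff F u (a *: v) = a * mdiff F u v.
Proof. by rewrite mulr_sumr; apply: eq_bigr => i _; rewrite mxE; ring. Qed.

Lemma mdiff_linform a u v : mdiff (linform a) u v = (linform a).@[v 0].
Proof.
rewrite mdiff_sum raddf_sum; apply: eq_bigr => i _.
rewrite mdiffZ /= mevalZ mevalXU; congr (_ * _).
rewrite /mdiff (bigD1 i) //= big1 => [|j ji]; rewrite mderivX mnmE.
  have -> : (U_(i) - U_(i))%MM = 0%MM :> 'X_{1..n.+1}.
    by apply/mnmP => k; rewrite mnmBE mnm0E subnn.
  by rewrite eqxx scale1r mpolyX0 meval1 mul1r addr0.
by rewrite eq_sym (negPf ji) scale0r meval0 mul0r.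
Qed.

Lemma linform_evalE a u : (linform a).@[u 0] = \sum_i a 0 i * u 0 i.
Proof. by rewrite raddf_sum; apply: eq_bigr => i _; rewrite /= mevalZ mevalXU. Qed.

Lemma linform_eval_sum (I : Type) (s : seq I) (p : pred I) (a : vec)
    (x : I -> K) (u : I -> vec) :
  (linform a).@[(\sum_(i <- s | p i) x i *: u i) 0] =
  \sum_(i <- s | p i) x i * (linform a).@[u i 0].
Proof.
rewrite linform_evalE; under eq_bigr => i _ do rewrite summxE mulr_sumr.
rewrite exchange_big; apply: eq_bigr => j _ /=.
by rewrite linform_evalE mulr_sumr; apply: eq_bigr => i _; rewrite mxE; ring.
Qed.

Lemma linform_homog a : linform a \is 1.-homog.
Proof. by apply: rpred_sum => i _; rewrite rpredZ // dhomogX /= mdeg1. Qed.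

Lemma meval_exp F k u : (F ^+ k).@[u 0] = F.@[u 0] ^+ k.
Proof. exact: rmorphXn. Qed.

Lemma homogX F d k : F \is d.-homog -> F ^+ k \is (d * k).-homog.
Proof. exact: dhomogMn. Qed.

Lemma homogX1 F k : F \is 1.-homog -> F ^+ k \is k.-homog.
Proof. by move=> hF; have := homogX k hF; rewrite mul1n. Qed.

Lemma homog_prod_seq (I : Type) (s : seq I) (p : pred I) (F : I -> R) (e : I -> nat) :
  (forall i, p i -> F i \is (e i).-homog) ->
  \prod_(i <- s | p i) F i \is (\sum_(i <- s | p i) e i)%N.-homog.
Proof.
move=> hF; elim/big_rec2: _ => [|i y x pi hx]; first exact: dhomog1.
exact/dhomogM/hx/hF.
Qed.

Lemma homog_scale F d a u :
  F \is d.-homog -> F.@[(a *: u) 0] = a ^+ d * F.@[u 0].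
Proof.
move=> /dhomogP hF; rewrite !mevalE mulr_sumr big_seq [RHS]big_seq.
apply: eq_bigr => m /hF <- /=; rewrite mdegE.
under eq_bigr => i _ do rewrite mxE exprMn.
by rewrite big_split /= prodrXr mulrCA.
Qed.

Lemma mderiv_homog F d i : F \is d.-homog -> F^`M(i) \is d.-1.-homog.
Proof.
move=> /dhomogP hF; apply/dhomogP => m; rewrite mcoeff_msupp mcoeff_deriv => h.
have /hF : (m + U_(i))%MM \in msupp F.
  by rewrite mcoeff_msupp; apply: contraNneq h => ->; rewrite mul0rn.
by rewrite /= mdegD mdeg1 addn1 => <-.
Qed.

Lemma homog_mdiff_scale F d a u v :
  F \is d.-homog -> mdiff F (a *: u) v = a ^+ d.-1 * mdiff F u v.
Proof.
move=> hF; rewrite mulr_sumr; apply: eq_bigr => i _.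
by rewrite (homog_scale _ _ (mderiv_homog i hF)) mulrA.
Qed.

Lemma mdiff_euler F d u : F \is d.-homog -> mdiff F u u = d%:R * F.@[u 0].
Proof.
move=> /dhomogP hF; rewrite [F in LHS]mpolyE [F in RHS]mpolyE mdiff_sum raddf_sum mulr_sumr.
rewrite big_seq [RHS]big_seq; apply: eq_bigr => m /hF <- /=.
rewrite mdiffZ mevalZ mulrCA; congr (_ * _).
rewrite mdegE natr_sum mulr_suml; apply: eq_bigr => i _.
rewrite mderivX mevalZ -mulrA; have [->|mi] := eqVneq (m i) 0%N; first by rewrite !mul0r.
congr (_ * _); rewrite -[u 0 i](mevalXU (u 0)) -mevalM -mpolyXD submK //.
by apply/mnm_lepP => j; rewrite mnm1E; case: eqP => // <-; rewrite lt0n.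
Qed.

Lemma eq_poly0_eval (p : {poly K}) : (forall a, p.[a] = 0) -> p = 0.
Proof.
move=> h; apply/eqP; apply/negPn/negP => /closed_nonrootP [x].
by rewrite rootE h eqxx.
Qed.

Definition rep P : vec := vpick (val P).

Lemma rep_neq0 P : rep P != 0.
Proof. by rewrite vpick0 -dimv_eq0 (eqP (valP P)). Qed.

Lemma rep_coord P : exists i, rep P 0 i != 0.
Proof.
apply/existsP; rewrite -negb_forall; apply: contra (rep_neq0 P) => /forallP h.
by apply/eqP/rowP => j; rewrite (eqP (h j)) mxE.
Qed.

Lemma val_rep P : val P = <[rep P]>%VS.
Proof.
apply/eqP; rewrite eq_sym eqEdim -memvE memv_pick /= dim_vline rep_neq0.
by rewrite (eqP (valP P)).
Qed.

Lemma mem_pointP P u : u \in val P -> exists a, u = a *: rep P.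
Proof. by rewrite val_rep => /vlineP. Qed.

Lemma rep_mem P : rep P \in val P.
Proof. by rewrite memv_pick. Qed.

Lemma point_inj P Q : rep P \in val Q -> P = Q.
Proof.
move=> h; apply/val_inj/eqP; rewrite eqEdim (eqP (valP P)) (eqP (valP Q)) leqnn.
by rewrite (val_rep P) -memvE h.
Qed.

Lemma vanishes_homog F d P :
  F \is d.-homog -> vanishes_at F P <-> F.@[rep P 0] = 0.
Proof.
move=> hF; split; first by apply; exact: rep_mem.
by move=> h u /mem_pointP [a ->]; rewrite (homog_scale _ _ hF) h mulr0.
Qed.

Lemma vi_homogP F d A : F \is d.-homog ->
  vanishing_ideal A F <-> (forall P, A P -> F.@[rep P 0] = 0).
Proof. by move=> hF; split=> h P /h /(vanishes_homog _ hF). Qed.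

Lemma vi0 A : vanishing_ideal A 0.
Proof. by move=> P _ u _; rewrite meval0. Qed.

Lemma viD A F G : vanishing_ideal A F -> vanishing_ideal A G ->
  vanishing_ideal A (F + G).
Proof. by move=> hF hG P AP u uP; rewrite mevalD (hF P) // (hG P) // addr0. Qed.

Lemma viM A F G : vanishing_ideal A F -> vanishing_ideal A (F * G).
Proof. by move=> hF P AP u uP; rewrite mevalM (hF P) // mul0r. Qed.

Lemma viMl A F G : vanishing_ideal A F -> vanishing_ideal A (G * F).
Proof. by rewrite mulrC; exact: viM. Qed.

Lemma viZ A F a : vanishing_ideal A F -> vanishing_ideal A (a *: F).
Proof. by move=> hF; rewrite -mul_mpolyC; exact: viMl. Qed.

Lemma viN A F : vanishing_ideal A F -> vanishing_ideal A (- F).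
Proof. by rewrite -scaleN1r; exact: viZ. Qed.

Lemma viB A F G : vanishing_ideal A F -> vanishing_ideal A G ->
  vanishing_ideal A (F - G).
Proof. by move=> hF hG; apply/viD/viN. Qed.

Lemma vi_sum A (I : Type) (s : seq I) (p : pred I) (F : I -> R) :
  (forall i, p i -> vanishing_ideal A (F i)) ->
  vanishing_ideal A (\sum_(i <- s | p i) F i).
Proof. by move=> h; elim/big_ind: _ => //; [exact: vi0 | exact: viD]. Qed.

Lemma viS A B F : A `<=` B -> vanishing_ideal B F -> vanishing_ideal A F.
Proof. by move=> AB hF P /AB; exact: hF. Qed.

(** Along the line through u, F restricts to a polynomial in one variable
    whose coefficients are the values at u of the homogeneous components; the
    field is infinite, so a zero polynomial function has zero coefficients. *)
Lemma vi_pihomog A F k : vanishing_ideal A F -> vanishing_ideal A (pihomog mdeg k F).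
Proof.
move=> hF P AP u uP.
pose N := maxn k.+1 (msize F).
pose p : {poly K} := \poly_(i < N) (pihomog mdeg i F).@[u 0].
suff p0 : p = 0.
  by have := coef0 K k; rewrite -p0 coef_poly leq_max ltnSn.
apply: eq_poly0_eval => a; rewrite horner_poly.
have /(hF P AP) : a *: u \in val P by rewrite rpredZ.
rewrite [F in F.@[_]](@pihomog_partitionE _ _ mdeg N) ?leq_maxr // raddf_sum.
move=> E; rewrite -[RHS]E; apply: eq_bigr => i _ /=.
by rewrite (homog_scale _ _ (pihomogP _ _ _)) mulrC.
Qed.

Lemma mpoly_pihomog F : F = \sum_(d < msize F) pihomog mdeg d F.
Proof. exact: pihomog_partitionE. Qed.

End Polynomials.

(** * Hilbert functions *)

(** Subspaces given by classical conditions become {vspace _}: a subspace of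
    maximal dimension inside P exhausts P, for any further vector would enlarge
    it. *)
Lemma ex_vspace (K : fieldType) (V : vectType K) (P : V -> Prop) :
  P 0 -> (forall a x y, P x -> P y -> P (a *: x + y)) ->
  exists U : {vspace V}, forall x, x \in U <-> P x.
Proof.
move=> P0 PD.
pose good m := `[< exists2 U : {vspace V}, forall x, x \in U -> P x & \dim U = m >].
have g0 : exists m, good m.
  exists 0%N; apply/asboolP; exists 0%VS; last exact: dimv0.
  by move=> x; rewrite memv0 => /eqP ->.
have gle m : good m -> (m <= \dim {:V})%N.
  by move=> /asboolP [U _ <-]; rewrite dimvS ?subvf.
case: (ex_maxnP g0 gle) => m /asboolP [U UP dU] mmax.
exists U => x; split; first exact: UP.
move=> Px; have : (\dim (U + <[x]>) <= \dim U)%N.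
  rewrite dU; apply: mmax; apply/asboolP; exists (U + <[x]>)%VS => // y.
  case/memv_addP => u uU [v /vlineP [a ->] ->]; rewrite addrC.
  by apply: PD => //; exact: UP.
move=> le; have /eqP eqU : U == (U + <[x]>)%VS.
  by rewrite eqEdim addvSl.
by rewrite eqU memvE addvSr.
Qed.

Section HilbertFunction.
Variables (K : closedFieldType) (n : nat).
Local Notation R := {mpoly K[n.+1]}.
Local Notation vec := 'rV[K]_n.+1.
Local Notation psp := (pspace K n).
Implicit Types (F G : R) (u v w : vec) (P Q : psp) (A B C T : set psp) (t m : nat).

Definition hge A t m : Prop :=
  quot_dim_ge (fun (a : K) (F : R) => a *: F)
    [set F : R | F \is t.-homog] (vanishing_ideal A) m.

Lemma ex_vi_vspace A t : exists U : {vspace dhomog n.+1 K t},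
  forall F : dhomog n.+1 K t, F \in U <-> vanishing_ideal A (val F).
Proof.
apply: ex_vspace => [|a x y hx hy]; first exact: vi0.
by rewrite linearP; apply: viD => //; exact: viZ.
Qed.

Definition vi_vspace A t := projT1 (cid (ex_vi_vspace A t)).

Lemma mem_vi_vspace A t (F : dhomog n.+1 K t) :
  F \in vi_vspace A t <-> vanishing_ideal A (val F).
Proof. by rewrite /vi_vspace; case: cid. Qed.

Definition hilb A t : nat := (\dim {: dhomog n.+1 K t} - \dim (vi_vspace A t))%N.

(** A family independent modulo the ideal spans a space that meets the ideal
    in 0; conversely a complement of the ideal has a basis of the maximal size. *)
Lemma hgeP A t m : hge A t m <-> (m <= hilb A t)%N.
Proof.
set U := vi_vspace A t; split.
  move=> [v [hv indep]].
  pose X := [tuple DHomog (hv i) | i < m].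
  have Xi (i : 'I_m) : val X`_i = v i by rewrite -tnth_nth tnth_mktuple.
  have fX : free X.
    apply/freeP => k /(congr1 val); rewrite raddf_sum => E i.
    apply: indep.
    rewrite (_ : \sum_i _ = 0); first exact: vi0.
    by rewrite -[RHS]E; apply: eq_bigr => j _; rewrite -Xi.
  have dX : \dim <<X>> = m by rewrite (eqP fX) size_tuple.
  have cap0 : (U :&: <<X>>)%VS = 0%VS.
    apply/eqP; rewrite -subv0; apply/subvP => x; rewrite memv_cap => /andP [xU xX].
    rewrite (coord_span xX) big1 ?mem0v // => i _.
    rewrite (indep (fun i => coord X i x)) ?scale0r //.
    move/mem_vi_vspace: xU; rewrite [x in val x](coord_span xX) raddf_sum.
    by congr (vanishing_ideal A _); apply: eq_bigr => j _; rewrite -Xi.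
  rewrite /hilb leq_subRL ?dimvS ?subvf // -{1}dX -dimv_disjoint_sum //.
  exact/dimvS/subvf.
rewrite /hilb -/U -dimv_compl => le_m.
pose X := vbasis U^C; pose v (i : 'I_m) : R := val X`_i.
exists v; split => [i|a]; first exact: dhomog_is_dhomog.
pose b (i : 'I_(\dim U^C)) : K := oapp a 0 (insub (val i)).
have E : \sum_i a i *: v i = val (\sum_i b i *: X`_i).
  rewrite raddf_sum (bigID (fun i : 'I_(\dim U^C) => (i < m)%N)) /=.
  rewrite [X in _ = _ + X]big1 ?addr0 => [|i /negPf im]; last first.
    by rewrite /b insubF // scale0r.
  pose F i := oapp a 0 (insub i) *: val X`_i.
  rewrite -(big_ord_widen (\dim U^C) F le_m); apply: eq_bigr => i _.
  by rewrite /F valK.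
rewrite E => /mem_vi_vspace hU i.
have : \sum_i b i *: X`_i \in (U :&: U^C)%VS.
  rewrite memv_cap hU /=; apply: memv_suml => j _; apply/memvZ/vbasis_mem.
  by apply: mem_nth; rewrite size_tuple.
rewrite capv_compl memv0 => /eqP hX.
have /freeP /(_ b hX (widen_ord le_m i)) := basis_free (vbasisP U^C).
by rewrite /b /= valK.
Qed.

Lemma hilbert_valueP A t m : hilbert_value A t m <-> m = hilb A t.
Proof.
rewrite /hilbert_value -/(hge A t m) -/(hge A t m.+1) !hgeP.
by split=> [[]|->]; lia.
Qed.

Lemma leq_hilb A t (I : finType) (v : I -> R) :
  (forall i, v i \is t.-homog) ->
  (forall a : I -> K, vanishing_ideal A (\sum_i a i *: v i) -> forall i, a i = 0) ->
  (#|I| <= hilb A t)%N.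
Proof.
move=> hv indep; apply/hgeP; exists (v \o enum_val); split => [i|a /= h i] /=.
  exact: hv.
rewrite -(enum_valK i); apply: (indep (a \o enum_rank)) => /=.
congr (vanishing_ideal A _): h; rewrite [RHS](reindex (enum_val : 'I_#|I| -> I)) /=.
  by apply: eq_bigr => j _; rewrite enum_valK.
exact/onW_bij/enum_val_bij.
Qed.

Lemma hilb_family A t : exists v : 'I_(hilb A t) -> R,
  (forall i, v i \is t.-homog) /\
  (forall a, vanishing_ideal A (\sum_i a i *: v i) -> forall i, a i = 0).
Proof. by have /hgeP [v [h1 h2]] := leqnn (hilb A t); exists v. Qed.

(** The ideal of the union is the intersection of the two ideals, and their
    sum is a proper subspace: all its members vanish at P. *)
Lemma hilb_union A B t P : A P -> B P ->
  (hilb (A `|` B) t < hilb A t + hilb B t)%N.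
Proof.
move=> AP BP; rewrite /hilb.
set U := vi_vspace A t; set V := vi_vspace B t.
have -> : vi_vspace (A `|` B) t = (U :&: V)%VS.
  apply/vspaceP => F; rewrite memv_cap; apply/idP/andP.
    by move=> /mem_vi_vspace h; split; apply/mem_vi_vspace; apply: viS h => x;
       [left|right].
  by move=> [/mem_vi_vspace h1 /mem_vi_vspace h2]; apply/mem_vi_vspace => Q [/h1|/h2].
have lt : (\dim (U + V) < \dim {:dhomog n.+1 K t})%N.
  rewrite ltnNge; apply/negP => le.
  have E : (U + V)%VS = fullv by apply/eqP; rewrite eqEdim subvf.
  have [i ui] := rep_coord P.
  have hX : ('X_i ^+ t : R) \is t.-homog by rewrite homogX1 // dhomogX /= mdeg1.
  have : DHomog hX \in (U + V)%VS by rewrite E memvf.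
  case/memv_addP => F /mem_vi_vspace hF [G /mem_vi_vspace hG] /(congr1 val) /= E'.
  have := congr1 (meval (rep P 0)) E'.
  rewrite mevalD (hF P) ?rep_mem // (hG P) ?rep_mem // rmorphXn /= mevalXU addr0.
  by move/eqP; rewrite expf_eq0 (negPf ui) andbF.
have := dimv_sum_cap U V.
have := dimvS (subvf U); have := dimvS (subvf V).
have := dimvS (capvSl U V); lia.
Qed.

(** There are more coefficients to choose than points to vanish at. *)
Lemma hilb_upper A t (I : finType) (u : I -> vec) : (#|I| < hilb A t)%N ->
  exists2 F, F \is t.-homog & ~ vanishing_ideal A F /\ forall i, F.@[u i 0] = 0.
Proof.
move=> lt; have [v [hv indep]] := hilb_family A t.
pose M := \matrix_(i < hilb A t, j < #|I|) (v i).@[u (enum_val j) 0].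
have kM : kermx M != 0.
  rewrite kermx_eq0 -row_leq_rank -ltnNge.
  exact: leq_ltn_trans (rank_leq_col M) lt.
have [a aM a0] : exists2 a : 'rV_(hilb A t), a *m M = 0 & a != 0.
  have /rowV0Pn [i ki i0] := kM; exists i => //.
  exact/sub_kermxP.
exists (\sum_i a 0 i *: v i); first by apply: rpred_sum => i _; rewrite rpredZ // hv.
split=> [/indep h|i].
  by case/negP: a0; apply/eqP/rowP => i; rewrite mxE; exact: h.
have := congr1 (fun B : 'rV_#|I| => B 0 (enum_rank i)) aM; rewrite !mxE => E.
rewrite -[RHS]E raddf_sum; apply: eq_bigr => j _ /=.
by rewrite mevalZ mxE enum_rankK.
Qed.

(** Multiplication by F embeds degree t into degree e + t, and the forms w are
    independent modulo its image.  In the applications this is seen from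
    functionals, values or derivatives at points, that kill the ideal and the
    multiples of F; so this is the inductive step of Bezout's inequality. *)
Lemma hilb_grow A F e t (I : finType) (w : I -> R) :
  F \is e.-homog ->
  (forall G, G \is t.-homog -> vanishing_ideal A (F * G) -> vanishing_ideal A G) ->
  (forall i, w i \is (e + t).-homog) ->
  (forall a G, G \is t.-homog ->
     vanishing_ideal A (\sum_i a i *: w i + F * G) -> forall i, a i = 0) ->
  (hilb A t + #|I| <= hilb A (e + t))%N.
Proof.
move=> hF reg hw indep; have [v [hv indv]] := hilb_family A t.
pose z (k : 'I_(hilb A t) + I) := match k with inl i => F * v i | inr i => w i end.
rewrite -[X in (X + _ <= _)%N]card_ord -card_sum; apply: (@leq_hilb _ _ _ z).
  by case=> i; [exact: dhomogM | exact: hw].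
move=> a; rewrite big_sumType /= => h.
have E : \sum_i a (inl i) *: (F * v i) = F * \sum_i a (inl i) *: v i.
  by rewrite mulr_sumr; apply: eq_bigr => i _; rewrite scalerAr.
have hG : \sum_i a (inl i) *: v i \is t.-homog.
  by apply: rpred_sum => i _; rewrite rpredZ // hv.
have aw : forall i, a (inr i) = 0.
  by apply: (indep (a \o inr) _ hG); rewrite addrC -E.
case=> // i; apply: (indv (a \o inl)); apply: reg => //.
by move: h; rewrite [X in _ + X]big1 ?addr0 ?E // => j _; rewrite aw scale0r.
Qed.

(** A multiple of G i restricts to 0 on every C j other than C i, so the
    contributions of the different C i are independent in degree t. *)
Lemma hilb_sum (s : nat) (C : 'I_s -> set psp) T (G : 'I_s -> R)
    (e t' : 'I_s -> nat) t :
  (forall i, C i `<=` T) ->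
  (forall i, G i \is (e i).-homog) ->
  (forall i j, j != i -> vanishing_ideal (C j) (G i)) ->
  (forall i F, F \is (t' i).-homog ->
     vanishing_ideal (C i) (G i * F) -> vanishing_ideal (C i) F) ->
  (forall i, e i + t' i = t)%N ->
  (\sum_i hilb (C i) (t' i) <= hilb T t)%N.
Proof.
move=> CT hG Goff reg et.
have fam i := cid (hilb_family (C i) (t' i)).
pose v i := projT1 (fam i).
have [hv indv] : (forall i j, v i j \is (t' i).-homog) /\ (forall i a,
    vanishing_ideal (C i) (\sum_j a j *: v i j) -> forall j, a j = 0).
  by split=> i; have [] := projT2 (fam i).
pose J := {i : 'I_s & 'I_(hilb (C i) (t' i))}.
have -> : (\sum_i hilb (C i) (t' i) = #|{: J}|)%N.
  by rewrite card_tagged sumnE big_map big_enum; apply: eq_bigr => i _; rewrite card_ord.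
pose z (k : J) := G (tag k) * v _ (tagged k).
apply: (@leq_hilb _ _ _ z) => [k|a h [i j]].
  by rewrite -(et (tag k)); apply: dhomogM.
pose b (i : 'I_s) (j : 'I_(hilb (C i) (t' i))) : K :=
  a (Tagged (fun i => 'I_(hilb (C i) (t' i))) j).
suff : forall j, b i j = 0 by apply.
apply: indv.
apply: reg; first by apply: rpred_sum => k _; rewrite rpredZ // hv.
have {h} := viS (CT i) h.
have -> : \sum_k a k *: z k = \sum_i \sum_j b i j *: (G i * v i j).
  by rewrite sig_big_dep; apply: eq_bigr => -[].
rewrite (bigD1 i) //= => h.
have off : vanishing_ideal (C i) (\sum_(k | k != i) \sum_l b k l *: (G k * v k l)).
  apply: vi_sum => k ki; apply: vi_sum => l _.
  by apply/viZ/viM/Goff; rewrite eq_sym.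
have := viB h off; rewrite addrK mulr_sumr.
by congr (vanishing_ideal _ _); apply: eq_bigr => l _; rewrite scalerAr.
Qed.

End HilbertFunction.

(** * Zariski topology and linear spans *)

Section Varieties.
Variables (K : closedFieldType) (n : nat).
Local Notation R := {mpoly K[n.+1]}.
Local Notation vec := 'rV[K]_n.+1.
Local Notation psp := (pspace K n).
Implicit Types (F G : R) (u v w : vec) (P Q : psp) (A B C T : set psp) (t m : nat).

Lemma zl_homogP F d P : F \is d.-homog ->
  zero_locus [set F] P <-> F.@[rep P 0] = 0.
Proof.
move=> hF; rewrite -(vanishes_homog P hF); split; first exact.
by move=> h G ->.
Qed.

Lemma closed_form F d : F \is d.-homog -> zariski_closed (zero_locus [set F] : set psp).
Proof. by move=> hF; exists [set F]; split=> // G ->; exists d. Qed.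

Lemma closed_zl_vi A : zariski_closed (zero_locus (vanishing_ideal A)).
Proof.
exists [set F | vanishing_ideal A F /\ exists k, F \is k.-homog]; split=> [F []//|].
apply/seteqP; split=> P hP F; first by move=> [hF _]; exact: hP.
move=> hF u uP; rewrite [F]mpoly_pihomog raddf_sum big1 // => i _ /=.
apply: (hP (pihomog mdeg i F)) uP; split; first exact: vi_pihomog.
by exists i; exact: pihomogP.
Qed.

Lemma sub_zl_vi A : A `<=` zero_locus (vanishing_ideal A).
Proof. by move=> P AP F hF; exact: hF. Qed.

Lemma closed_vi A : zariski_closed A -> zero_locus (vanishing_ideal A) = A.
Proof.
move=> [E [_ ->]]; apply/seteqP; split; last exact: sub_zl_vi.
by move=> P hP F EF; apply: hP => Q; apply.
Qed.

Lemma closedU A B : zariski_closed A -> zariski_closed B -> zariski_closed (A `|` B).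
Proof.
move=> [E1 [h1 ->]] [E2 [h2 ->]].
exists [set F | exists G1 G2, [/\ E1 G1, E2 G2 & F = G1 * G2]]; split.
  move=> F [G1 [G2 [/h1 [k1 ?] /h2 [k2 ?] ->]]].
  by exists (k1 + k2)%N; exact: dhomogM.
apply/seteqP; split=> P.
  move=> [] hP F [G1 [G2 [e1 e2 ->]]] u uP; rewrite mevalM.
    by rewrite (hP _ e1) ?mul0r.
  by rewrite (hP _ e2) ?mulr0.
move=> hP; apply: contrapT => /not_orP [n1 n2].
have [G1 e1 g1] : exists2 G1, E1 G1 & ~ vanishes_at G1 P.
  by apply: contrapT => h; apply: n1 => F EF; apply: contrapT => hF; apply: h; exists F.
have [G2 e2 g2] : exists2 G2, E2 G2 & ~ vanishes_at G2 P.
  by apply: contrapT => h; apply: n2 => F EF; apply: contrapT => hF; apply: h; exists F.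
have [k1 hG1] := h1 _ e1; have [k2 hG2] := h2 _ e2.
have : (G1 * G2).@[rep P 0] = 0.
  by apply: (hP (G1 * G2)) (rep_mem P); exists G1, G2.
rewrite mevalM => /eqP; rewrite mulf_eq0 => /orP [] /eqP E.
  by apply: g1; apply/(vanishes_homog P hG1).
by apply: g2; apply/(vanishes_homog P hG2).
Qed.

Lemma closed0 : zariski_closed (set0 : set psp).
Proof.
exists [set 1]; split=> [F ->|]; first by exists 0%N; exact: dhomog1.
apply/seteqP; split=> // P /(_ 1 erefl (rep P) (rep_mem P)) /eqP.
by rewrite meval1 oner_eq0.
Qed.

Lemma closed_bigU (I : Type) (s : seq I) (p : pred I) (A : I -> set psp) :
  (forall i, p i -> zariski_closed (A i)) ->
  zariski_closed (\big[setU/set0]_(i <- s | p i) A i).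
Proof. by move=> h; elim/big_ind: _ => //; [exact: closed0 | exact: closedU]. Qed.

(** The zero loci of F and G cover C. *)
Lemma irr_prime C F G d e : zariski_irreducible C ->
  F \is d.-homog -> G \is e.-homog ->
  vanishing_ideal C (F * G) -> vanishing_ideal C F \/ vanishing_ideal C G.
Proof.
move=> [_ irr] hF hG hFG.
have cov : C `<=` zero_locus [set F] `|` zero_locus [set G].
  move=> P CP; have := hFG P CP _ (rep_mem P).
  rewrite mevalM => /eqP; rewrite mulf_eq0 => /orP [] /eqP E; [left|right].
    exact/(zl_homogP P hF).
  exact/(zl_homogP P hG).
by case: (irr _ _ (closed_form hF) (closed_form hG) cov) => h; [left|right];
   move=> P /h; apply.
Qed.

Lemma irr_regular C F d : zariski_irreducible C -> F \is d.-homog ->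
  ~ vanishing_ideal C F -> forall e G, G \is e.-homog ->
  vanishing_ideal C (F * G) -> vanishing_ideal C G.
Proof. by move=> irr hF nF e G hG /(irr_prime irr hF hG) []. Qed.

Lemma irr_prod C (I : Type) (s : seq I) (p : pred I) (F : I -> R) (e : I -> nat) :
  zariski_irreducible C -> (forall i, p i -> F i \is (e i).-homog) ->
  (forall i, p i -> ~ vanishing_ideal C (F i)) ->
  ~ vanishing_ideal C (\prod_(i <- s | p i) F i).
Proof.
move=> irr hF nF; pose good G := (exists k, G \is k.-homog) /\ ~ vanishing_ideal C G.
suff [] : good (\prod_(i <- s | p i) F i) by [].
elim/big_ind: _ => [|G H [[k hG] nG] [[l hH] nH]|i pi]; last 2 first.
- split; first by exists (k + l)%N; exact: dhomogM.
  by move=> /(irr_prime irr hG hH) [].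
- by split; [exists (e i); exact: hF | exact: nF].
split; first by exists 0%N; exact: dhomog1.
have [[P CP] _] := irr; move=> /(_ P CP _ (rep_mem P)) /eqP.
by rewrite meval1 oner_eq0.
Qed.

Lemma not_viP A F d : F \is d.-homog -> ~ vanishing_ideal A F ->
  exists2 P, A P & F.@[rep P 0] != 0.
Proof.
move=> hF nF; apply: contrapT => h; apply: nF; apply/(vi_homogP _ hF) => P AP.
by apply: contrapT => /eqP nz; apply: h; exists P.
Qed.

Lemma closed_sep A P : zariski_closed A -> ~ A P ->
  exists d F, [/\ F \is d.-homog, vanishing_ideal A F & F.@[rep P 0] != 0].
Proof.
move=> [E [hE ->]] nP; apply: contrapT => h; apply: nP => F EF.
have [d hF] := hE F EF; apply/(vanishes_homog P hF)/eqP/negPn/negP => nz.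
by apply: h; exists d, F; split=> // Q; apply.
Qed.

Lemma irr_subU C (I : finType) (p : pred I) (A : I -> set psp) :
  zariski_irreducible C -> (forall i, p i -> zariski_closed (A i)) ->
  C `<=` \big[setU/set0]_(i | p i) A i -> exists2 i, p i & C `<=` A i.
Proof.
move=> irr hA; rewrite -big_filter.
have : forall i, i \in [seq i <- index_enum I | p i] -> p i.
  by move=> i; rewrite mem_filter => /andP [].
elim: [seq _ <- _ | _] => [|i s IH] hs; first by rewrite big_nil => h; have [[P /h]] := irr.
rewrite big_cons => h; have [] := irr.2 _ _ _ _ h.
- by apply/hA/hs; rewrite inE eqxx.
- rewrite big_seq_cond; apply: closed_bigU => j; rewrite andbT => js.
  by apply/hA/hs; rewrite inE js orbT.
- by move=> Ci; exists i => //; apply: hs; rewrite inE eqxx.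
by move=> /(IH _); apply=> j js; apply: hs; rewrite inE js orbT.
Qed.

Lemma irr_zl C : zariski_irreducible C ->
  zariski_irreducible (zero_locus (vanishing_ideal C)).
Proof.
move=> [[P CP] irr]; split; first by exists P; exact: sub_zl_vi.
move=> Z1 Z2 c1 c2 cov.
have sub Z : zariski_closed Z -> C `<=` Z -> zero_locus (vanishing_ideal C) `<=` Z.
  by move=> cZ CZ; rewrite -[Z]closed_vi // => Q hQ F hF; apply: hQ; exact: viS hF.
have [] := irr _ _ c1 c2; first by move=> Q /sub_zl_vi /cov.
- by move=> /(sub _ c1); left.
- by move=> /(sub _ c2); right.
Qed.

(** The closure of an irreducible set is irreducible, so maximality leaves no
    room between a component and its closure. *)
Lemma component_closed T C : zariski_closed T -> irreducible_component T C ->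
  zariski_closed C.
Proof.
move=> cT [irr CT mx]; rewrite -(mx _ (irr_zl irr)); first exact: closed_zl_vi.
- by rewrite -(closed_vi cT) => P hP F hF; apply: hP; exact: viS hF.
- exact: sub_zl_vi.
Qed.

Lemma irr_point P : zariski_irreducible [set P].
Proof.
split=> [|Z1 Z2 _ _ h]; first by exists P.
by case: (h P erefl) => hP; [left|right] => Q ->.
Qed.

(** The union of a chain of irreducible sets is irreducible, so Zorn's lemma
    enlarges the point P to a component. *)
Lemma component_cover T P : T P -> exists2 C, irreducible_component T C & C P.
Proof.
move=> TP.
pose good A := A `<=` T /\ (A = set0 \/ (zariski_irreducible A /\ A P)).
have [|A [[AT hA] Amax]] := @Zorn_bigcup psp good.
  move=> F FP Ftot; split; first by move=> Q [X FX XQ]; exact: (FP X FX).1.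
  have [[X [FX XP]]|no] := pselect (exists X, F X /\ X P); last first.
    left; apply/seteqP; split=> // Q [X FX XQ]; apply: no; exists X; split=> //.
    by have [_ [X0|[]//]] := FP X FX; move: XQ; rewrite X0.
  right; split; last by exists X.
  split; first by exists P, X.
  move=> Z1 Z2 c1 c2 cov; apply: contrapT => /not_orP [n1 n2].
  have irrF Y Q : F Y -> Y Q -> zariski_irreducible Y.
    by move=> FY YQ; have [_ [Y0|[]//]] := FP Y FY; move: YQ; rewrite Y0.
  have {}irrF Y Q : F Y -> Y Q -> Y `<=` Z1 \/ Y `<=` Z2.
    move=> FY YQ; apply: (irrF Y Q FY YQ).2 => // x Yx; apply: cov; by exists Y.
  have [Q1 [Y1 FY1 YQ1] z1] : exists2 Q, (\bigcup_(X in F) X) Q & ~ Z1 Q.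
    by apply: contrapT => h; apply: n1 => Q hQ; apply: contrapT => nz; apply: h; exists Q.
  have [Q2 [Y2 FY2 YQ2] z2] : exists2 Q, (\bigcup_(X in F) X) Q & ~ Z2 Q.
    by apply: contrapT => h; apply: n2 => Q hQ; apply: contrapT => nz; apply: h; exists Q.
  have [Y12|Y21] := Ftot _ _ FY1 FY2.
    by have [h|h] := irrF _ _ FY2 YQ2; [apply/z1/h/Y12 | apply/z2/h].
  by have [h|h] := irrF _ _ FY1 YQ1; [apply/z1/h | apply/z2/h/Y21].
have [irrA AP] : zariski_irreducible A /\ A P.
  case: hA => // A0; case: (Amax [set P]).
    rewrite A0; split=> [x //|h]; exact: (h P erefl).
  by split; [move=> Q -> | right; split => //; exact: irr_point].
exists A => //; split=> // C' irrC' C'T AC'.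
apply: contrapT => ne; apply: (Amax C').
  split=> // h; apply: ne; apply/seteqP; by split.
by split=> //; right; split => //; exact: AC'.
Qed.

Lemma ex_span A : exists U : {vspace vec}, forall v, v \in U <->
  (forall W : {vspace vec}, (forall P, A P -> (val P <= W)%VS) -> v \in W).
Proof.
apply: ex_vspace => [W _|a x y hx hy W hW]; first exact: mem0v.
by rewrite memvD ?memvZ ?hx ?hy.
Qed.

Definition linspan A : {vspace vec} := projT1 (cid (ex_span A)).

Lemma linspan_sub A P : A P -> (val P <= linspan A)%VS.
Proof.
move=> AP; apply/subvP => v vP; rewrite /linspan; case: cid => U /= ->.
by move=> W /(_ P AP) /subvP; apply.
Qed.

Lemma linspan_rep A P : A P -> rep P \in linspan A.
Proof. by move=> /linspan_sub /subvP; apply; exact: rep_mem. Qed.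

Lemma linspan_min A (W : {vspace vec}) :
  (forall P, A P -> (val P <= W)%VS) -> (linspan A <= W)%VS.
Proof.
by move=> h; apply/subvP => v; rewrite /linspan; case: cid => U /= hU /hU; apply.
Qed.

Lemma linspanS A B : A `<=` B -> (linspan A <= linspan B)%VS.
Proof. by move=> AB; apply: linspan_min => P /AB; exact: linspan_sub. Qed.

Lemma linspanU A B : linspan (A `|` B) = (linspan A + linspan B)%VS.
Proof.
apply/eqP; rewrite eqEsubv subv_add !linspanS ?andbT //.
by apply: linspan_min => P [] /linspan_sub h;
   apply: subv_trans h _; rewrite ?addvSl ?addvSr.
Qed.

Lemma linspan_spans A : spans A -> linspan A = fullv.
Proof. by apply; exact: linspan_sub. Qed.

Lemma linform_vspace a : exists W : {vspace vec},
  forall u, u \in W <-> (linform a).@[u 0] = 0.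
Proof.
apply: ex_vspace => [|b x y hx hy]; rewrite !linform_evalE.
  by rewrite big1 // => i _; rewrite mxE mulr0.
under eq_bigr => i _ do rewrite !mxE mulrDr mulrCA.
by rewrite big_split /= -mulr_sumr -!linform_evalE hx hy mulr0 addr0.
Qed.

Lemma vi_linform A a : vanishing_ideal A (linform a) <->
  (forall u, u \in linspan A -> (linform a).@[u 0] = 0).
Proof.
split=> [hA u|h P AP u uP]; last by apply: h; move/subvP: (linspan_sub AP); apply.
have [W hW] := linform_vspace a; have : (linspan A <= W)%VS.
  by apply: linspan_min => P AP; apply/subvP => v vP; apply/hW/(hA P).
by move=> /subvP /[apply] /hW.
Qed.

Lemma functional_linform (f : vec -> K) : scalar f ->
  exists a, forall u, (linform a).@[u 0] = f u.
Proof.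
move=> lf; pose fL : {scalar vec} := HB.pack f (GRing.isLinear.Build _ _ _ _ f lf).
exists (\row_i f (delta_mx 0 i)) => u.
rewrite linform_evalE [in RHS](row_sum_delta u) -[f]/(fL : vec -> K) linear_sum.
by apply: eq_bigr => i _; rewrite mxE linearZ /= mulrC.
Qed.

Lemma dual_linforms m (X : m.-tuple vec) : free X ->
  exists a : 'I_m -> vec, forall i j : 'I_m, (linform (a i)).@[X`_j 0] = (i == j)%:R.
Proof.
move=> fX; have h i : exists a, forall u, (linform a).@[u 0] = coord X i u.
  by apply: functional_linform => b x y; rewrite linearP.
have [a ha] := choice h; exists a => i j.
by rewrite ha coord_free // eq_sym.
Qed.

Lemma sep_linform (U : {vspace vec}) v : v \notin U ->
  exists2 a, (linform a).@[v 0] = 1 & forall u, u \in U -> (linform a).@[u 0] = 0.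
Proof.
move=> vU; pose X := [tuple of v :: vbasis U].
have fX : free X by rewrite /= free_cons (basis_free (vbasisP U)) (span_basis (vbasisP U)) vU.
have [a ha] := dual_linforms fX.
exists (a ord0); first exact: (ha ord0 ord0).
move=> u /coord_vbasis ->; rewrite linform_eval_sum big1 // => i _.
by have := ha ord0 (lift ord0 i); rewrite /= => ->; rewrite mulr0.
Qed.

(** A maximal free family of representatives of points of A spans already. *)
Lemma ex_cone_basis A : exists s : seq psp,
  [/\ forall P, P \in s -> A P, free (map (@rep K n) s) & size s = \dim (linspan A)].
Proof.
pose good m := `[< exists s : seq psp,
  [/\ forall P, P \in s -> A P, free (map (@rep K n) s) & size s = m] >].
have g0 : exists m, good m.
  by exists 0%N; apply/asboolP; exists [::]; split=> //; exact: nil_free.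
have gle m : good m -> (m <= \dim {: vec})%N.
  move=> /asboolP [s [_ /eqP fs <-]].
  by rewrite -(size_map (@rep K n)) -fs dimvS ?subvf.
case: (ex_maxnP g0 gle) => m /asboolP [s [sA fs sm]] mmax.
exists s; split=> //; rewrite -(size_map (@rep K n)) -(eqP fs); congr (\dim _).
apply/eqP; rewrite eqEsubv; apply/andP; split.
  by apply/span_subvP => v /mapP [P /sA /linspan_rep h ->].
apply: linspan_min => P AP; rewrite val_rep -memvE; apply/negPn/negP => nP.
suff : (m.+1 <= m)%N by rewrite ltnn.
apply: mmax; apply/asboolP; exists (P :: s); split=> [Q||] /=; last by rewrite sm.
  by rewrite inE => /predU1P [->|/sA].
by rewrite free_cons nP.
Qed.

Lemma sep_points P Q : P != Q ->
  exists2 a, (linform a).@[rep P 0] = 1 & (linform a).@[rep Q 0] = 0.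
Proof.
move=> PQ; have [|a a1 a0] := @sep_linform (val Q) (rep P).
  by apply: contraNN PQ => /point_inj ->.
by exists a => //; apply: a0; exact: rep_mem.
Qed.

Lemma unit_linform P : exists a, (linform a).@[rep P 0] = 1.
Proof.
have [|a a1 _] := @sep_linform 0%VS (rep P); first by rewrite memv0 rep_neq0.
by exists a.
Qed.

Lemma sep_form P (s : seq psp) : P \notin s ->
  exists D, [/\ D \is (size s).-homog, D.@[rep P 0] = 1 &
    forall Q, Q \in s -> D.@[rep Q 0] = 0].
Proof.
elim: s => [_|Q s IH]; first by exists 1; split=> //; [exact: dhomog1 | exact: meval1].
rewrite inE negb_or => /andP [PQ /IH [D [hD D1 D0]]].
have [a a1 a0] := sep_points PQ; exists (linform a * D); split=> /=.
- by apply: (@dhomogM _ _ _ 1%N) => //; exact: linform_homog.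
- by rewrite mevalM a1 D1 mulr1.
by move=> Q'; rewrite inE mevalM => /predU1P [->|/D0 ->]; rewrite ?a0 ?mul0r ?mulr0.
Qed.

(** Products of linear forms, each vanishing at one point and not at another,
    padded to degree m by powers of a linear form. *)
Lemma dual_forms N (q : 'I_N -> psp) m : injective q -> (N <= m)%N ->
  exists D : 'I_N -> R, (forall i, D i \is m.-homog) /\
    forall i j, (D i).@[rep (q j) 0] = (i == j)%:R.
Proof.
move=> qi Nm; have h i : exists D, D \is m.-homog /\
    forall j, D.@[rep (q j) 0] = (i == j)%:R.
  pose s := [seq q j | j <- enum 'I_N & j != i].
  have ss : (size s <= m)%N.
    rewrite size_map size_filter; apply: leq_trans (count_size _ _) _.
    by rewrite size_enum_ord.
  have [|D [hD D1 D0]] := @sep_form (q i) s.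
    by apply/mapP => -[j]; rewrite mem_filter => /andP [ji _] /qi E; rewrite E eqxx in ji.
  have [a a1] := unit_linform (q i).
  exists (D * linform a ^+ (m - size s)); split=> [|j].
    by have := dhomogM hD (homogX1 (m - size s) (linform_homog a)); rewrite subnKC.
  rewrite mevalM meval_exp; have [<-|ji] := eqVneq i j.
    by rewrite D1 a1 expr1n mulr1.
  rewrite D0 ?mul0r //; apply/mapP; exists j => //.
  by rewrite mem_filter eq_sym ji mem_enum.
have [D hD] := choice h.
by exists D; split=> i; have [] := hD i.
Qed.

End Varieties.

(** * Irreducible curves and Bezout bounds *)

(** Bezout's inequality, for a function only known to be r t + O(1): applying
    the second hypothesis k times gains k N while the degree grows by k e, so
    linear growth of slope r bounds k N by k r e + O(1) for every k. *)
Lemma slope_bound (f : nat -> nat) (r c t0 t1 e N : nat) :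
  (forall t, (t0 <= t)%N -> (f t <= r * t + c)%N) ->
  (forall t, (t1 <= t)%N -> (f t + N <= f (e + t))%N) ->
  (N <= r * e)%N.
Proof.
move=> up grow; set m := maxn t0 t1.
have low k : (k * N <= f (k * e + m))%N.
  elim: k => // k IH; rewrite mulSn mulSn -addnA.
  apply: leq_trans (grow _ _); first by rewrite addnC leq_add2r.
  by apply: leq_trans (leq_maxr t0 t1) (leq_addl _ _).
rewrite leqNgt; apply/negP => lt.
(* k exceeds the constant term that the upper bound leaves *)
set k := (r * m + c).+1.
have := leq_trans (low k) (up _ (leq_trans (leq_maxl t0 t1) (leq_addl _ _))).
have : (k * (r * e).+1 <= k * N)%N by rewrite leq_mul2l lt orbT.
rewrite mulnS mulnDr mulnCA /k; lia.
Qed.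

Section IrreducibleCurves.
Variables (K : closedFieldType) (n : nat).
Local Notation R := {mpoly K[n.+1]}.
Local Notation vec := 'rV[K]_n.+1.
Local Notation psp := (pspace K n).
Implicit Types (F G : R) (u v w : vec) (P Q : psp) (A B C T : set psp) (t m : nat).

Definition two_points C := exists P Q, [/\ C P, C Q & P != Q].

(** For each point of s some linear form vanishes there but not on C; their
    product does not vanish on C either. *)
Lemma irr_infinite C (s : seq psp) : zariski_irreducible C -> two_points C ->
  exists2 P, C P & P \notin s.
Proof.
move=> irr [P1 [P2 [C1 C2 P12]]].
have h Q : exists a, ~ vanishing_ideal C (linform a) /\ (linform a).@[rep Q 0] = 0.
  have [P CP PQ] : exists2 P, C P & P != Q.
    by have [E|ne] := eqVneq P1 Q; [exists P2; rewrite // -E eq_sym | exists P1].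
  have [a a1 a0] := sep_points PQ; exists a; split=> // /(_ P CP _ (rep_mem P)) /eqP.
  by rewrite a1 oner_eq0.
have [a ha] := choice h.
pose F : R := \prod_(Q <- s) linform (a Q).
have hF : F \is (\sum_(Q <- s) 1)%N.-homog.
  by apply: homog_prod_seq => Q _; exact: linform_homog.
have nF : ~ vanishing_ideal C F.
  apply: (irr_prod (e := fun=> 1%N)) => // Q _; first exact: linform_homog.
  exact: (ha Q).1.
have [P CP FP] := not_viP hF nF.
exists P => //; apply: contraNN FP => Ps.
rewrite /F rmorph_prod /= prodf_seq_eq0; apply/hasP; exists P => //=.
by rewrite (ha P).2.
Qed.

Lemma irr_points C (s : seq psp) N : zariski_irreducible C -> two_points C ->
  exists q : 'I_N -> psp,
    [/\ injective q, forall i, C (q i) & forall i, q i \notin s].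
Proof.
move=> irr nt; have [l [ul sl lC]] : exists l : seq psp,
    [/\ uniq l, size l = N & forall P, P \in l -> C P /\ P \notin s].
  elim: N => [|N [l [ul sl lC]]]; first by exists [::].
  have [P CP] := irr_infinite (s ++ l) irr nt.
  rewrite mem_cat negb_or => /andP [Ps Pl].
  exists (P :: l); split=> /= [||Q]; rewrite ?Pl ?sl // inE.
  by move=> /predU1P [->//|/lC].
have [[x0 _] _] := irr.
exists (fun i => nth x0 l i); split=> [i j /eqP|i|i].
- by rewrite nth_uniq ?sl // => /eqP /val_inj.
- by have [] := lC (nth x0 l i) (mem_nth _ _); rewrite ?sl.
- by have [] := lC (nth x0 l i) (mem_nth _ _); rewrite ?sl.
Qed.

Lemma linspan_gt0 C : zariski_irreducible C -> (0 < \dim (linspan C))%N.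
Proof.
move=> [[P /linspan_sub /dimvS h] _]; apply: leq_trans h.
by rewrite (eqP (valP P)).
Qed.

Lemma linspan_gt1 C : two_points C -> (1 < \dim (linspan C))%N.
Proof.
move=> [P [Q [CP CQ PQ]]].
rewrite ltnNge; apply/negP => le; case/eqP: PQ; apply: point_inj.
have /eqP -> : val Q == linspan C.
  by rewrite eqEdim linspan_sub //= (eqP (valP Q)).
exact: linspan_rep.
Qed.

(** Take a basis of the span of C consisting of points of C.  The hyperplane
    through all of them but one does not contain C, and the values at the r
    points on it are independent on forms of any positive degree; so each step
    in degree gains r. *)
Lemma hilb_lower C r t : zariski_irreducible C -> \dim (linspan C) = r.+1 ->
  (r * t + 1 <= hilb C t)%N.
Proof.
move=> irr dC; have [s [sC fs ss]] := ex_cone_basis C.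
have sz : size (map (@rep K n) s) == r.+1 by rewrite size_map ss dC.
have [a ha] := @dual_linforms _ _ _ (Tuple sz) fs.
have [[P0 CP0] _] := irr.
have [x [xC {}ha]] : exists x : 'I_r.+1 -> psp, (forall j, C (x j)) /\
    forall i j, (linform (a i)).@[rep (x j) 0] = (i == j)%:R.
  exists (fun j => nth P0 s j); split=> [j|i j]; first by apply/sC/mem_nth; rewrite ss dC.
  by rewrite -ha /= (nth_map P0) // ss dC.
have nF : ~ vanishing_ideal C (linform (a ord0)).
  move=> /(_ _ (xC ord0) _ (rep_mem _)) /eqP.
  by rewrite ha eqxx oner_eq0.
elim: t => [|t IH].
  rewrite muln0 add0n -card_unit; apply: (@leq_hilb _ _ _ _ _ (fun=> 1)).
    by move=> _; exact: dhomog1.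
  move=> b hb []; have := hb P0 CP0 _ (rep_mem P0).
  by rewrite (big_pred1 tt) => [|[]//]; rewrite mevalZ meval1 mulr1.
have : (hilb C t + r <= hilb C (1 + t))%N; last by rewrite add1n mulnS; lia.
rewrite -[X in (_ + X <= _)%N]card_ord.
apply: (@hilb_grow _ _ C (linform (a ord0)) _ _ _
          (fun i => linform (a (lift ord0 i)) ^+ (1 + t))).
- exact: linform_homog.
- by move=> G; apply: irr_regular => //; exact: linform_homog.
- move=> i; rewrite -[X in X.-homog]mul1n.
  exact/homogX/linform_homog.
move=> b G _ hb i; have := hb _ (xC (lift ord0 i)) _ (rep_mem _).
rewrite mevalD mevalM ha /= mul0r addr0 raddf_sum (bigD1 i) //= big1.
  by rewrite addr0 mevalZ meval_exp ha eqxx expr1n mulr1.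
move=> j ji; rewrite mevalZ meval_exp ha (inj_eq lift_inj) (negPf ji).
by rewrite exprS mul0r mulr0.
Qed.

(** The values at the points q i kill the multiples of F and are independent
    in degrees at least N. *)
Lemma hilb_points C F e N (q : 'I_N -> psp) t : zariski_irreducible C ->
  F \is e.-homog -> ~ vanishing_ideal C F ->
  injective q -> (forall i, C (q i)) -> (forall i, F.@[rep (q i) 0] = 0) ->
  (N <= t)%N -> (hilb C t + N <= hilb C (e + t))%N.
Proof.
move=> irr hF nF qi qC qF Nt.
have [D [hD Dq]] := dual_forms qi (leq_trans Nt (leq_addl e t)).
rewrite -[X in (_ + X <= _)%N]card_ord; apply: (@hilb_grow _ _ C F _ _ _ D) => //.
  by move=> G; exact: (irr_regular irr hF nF).
move=> b G _ hb i; have := hb _ (qC i) _ (rep_mem _).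
rewrite mevalD mevalM qF mul0r addr0 raddf_sum (bigD1 i) //= big1.
  by rewrite addr0 mevalZ Dq eqxx mulr1.
by move=> j ji; rewrite mevalZ Dq (negPf ji) mulr0.
Qed.

(** If the Hilbert function exceeded r t + 1, some form of degree t not
    vanishing on C would vanish at r t + 1 points of C, against Bezout. *)
Lemma hilb_exact C r c t0 t : zariski_irreducible C -> two_points C ->
  \dim (linspan C) = r.+1 ->
  (forall t, (t0 <= t)%N -> (hilb C t <= r * t + c)%N) ->
  hilb C t = (r * t + 1)%N.
Proof.
move=> irr nt dC up; apply/eqP; rewrite eqn_leq hilb_lower // andbT leqNgt.
apply/negP => lt; have [q [qi qC _]] := irr_points [::] (r * t + 1) irr nt.
have [|F hF [nF qF]] := @hilb_upper _ _ C t _ (fun i => rep (q i)).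
  by rewrite card_ord.
have := slope_bound up (fun m => hilb_points irr hF nF qi qC qF (t := m)).
by rewrite addn1 ltnn.
Qed.

Lemma curve_degree_linear C r : (forall t, hilb C t = (r * t + 1)%N) -> curve_degree C = r.
Proof.
move=> hC; apply: xget_unique.
  exists 1, 0%N => t _; exists (hilb C t); first exact/hilbert_valueP.
  by rewrite hC; lia.
move=> e [c [t0 he]].
have [m1 /hilbert_valueP -> E1] := he t0 (leqnn _).
have [m2 /hilbert_valueP -> E2] := he t0.+1 (leqnSn _).
by move: E1 E2; rewrite !hC mulnS; lia.
Qed.

Lemma curve_degree_bound T r : curve_degree T = r -> (0 < r)%N ->
  exists c t0, forall t, (t0 <= t)%N -> (hilb T t <= r * t + c)%N.
Proof.
rewrite /curve_degree; case: xgetP => [e -> [c [t0 h]] <- _|_ <- //].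
exists `|c|%N, t0 => t /h [m /hilbert_valueP ->]; lia.
Qed.

End IrreducibleCurves.

(** * Tangent spaces of affine cones *)

Section TangentSpaces.
Variables (K : closedFieldType) (n : nat).
Local Notation R := {mpoly K[n.+1]}.
Local Notation vec := 'rV[K]_n.+1.
Local Notation psp := (pspace K n).
Implicit Types (F G : R) (u v w : vec) (P Q : psp) (A B C T : set psp) (t m : nat).

Lemma ex_tangent A P : exists W : {vspace vec}, forall v, v \in W <->
  (forall F, vanishing_ideal A F -> mdiff F (rep P) v = 0).
Proof.
apply: ex_vspace => [F _|a x y hx hy F hF].
  by rewrite /mdiff big1 // => i _; rewrite mxE mulr0.
by rewrite mdiff_addr mdiff_scaler hx // hy // mulr0 addr0.
Qed.

(** The tangent space of the affine cone over A at a representative of P; it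
    has dimension 2 at a smooth point of a curve. *)
Definition tangent A P : {vspace vec} := projT1 (cid (ex_tangent A P)).

Lemma tangentP A P v : v \in tangent A P <->
  (forall F, vanishing_ideal A F -> mdiff F (rep P) v = 0).
Proof. by rewrite /tangent; case: cid. Qed.

Lemma mdiff_pihomog F u v : mdiff F u v = \sum_(k < msize F) mdiff (pihomog mdeg k F) u v.
Proof. by rewrite {1}[F]mpoly_pihomog mdiff_sum. Qed.

Lemma rep_tangent A P : A P -> rep P \in tangent A P.
Proof.
move=> AP; apply/tangentP => F hF; rewrite mdiff_pihomog big1 // => k _.
rewrite (mdiff_euler _ (pihomogP _ _ _)) (vi_pihomog k hF AP) ?mulr0 //.
exact: rep_mem.
Qed.

Lemma tangentS A B P : A `<=` B -> (tangent A P <= tangent B P)%VS.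
Proof.
by move=> AB; apply/subvP => v /tangentP h; apply/tangentP => F /(viS AB); exact: h.
Qed.

Lemma tangent_linspan A P : (tangent A P <= linspan A)%VS.
Proof.
apply/subvP => v /tangentP hv; apply/negPn/negP => /sep_linform [a a1 a0].
have /eqP := hv (linform a) ((vi_linform _ _).2 a0).
by rewrite mdiff_linform a1 oner_eq0.
Qed.

(** Multiplying an equation of A by G gives an equation of the union, with
    proportional differential at P. *)
Lemma tangent_local A B P G : A P -> vanishing_ideal B G -> G.@[rep P 0] != 0 ->
  tangent (A `|` B) P = tangent A P.
Proof.
move=> AP hG GP; have sAB : A `<=` A `|` B by move=> Q; left.
apply/eqP; rewrite eqEsubv (tangentS P sAB) andbT.
apply/subvP => v /tangentP hv; apply/tangentP => F hF.
have /hv : vanishing_ideal (A `|` B) (F * G).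
  by move=> Q [/(viM G hF)|/(viMl F hG)].
rewrite mdiffM (hF P AP) ?rep_mem // mul0r addr0 => /eqP.
by rewrite mulf_eq0 (negPf GP) orbF => /eqP.
Qed.

Lemma smooth_locusP T P : smooth_locus T P <-> T P /\ \dim (tangent T P) = 2%N.
Proof.
have key v : v \in tangent T P <-> (forall F u, vanishing_ideal T F ->
    u \in val P -> u != 0 -> \sum_(i < n.+1) (F^`M(i)).@[u 0] * v 0 i = 0).
  split=> [/tangentP hv F u hF /mem_pointP [a ->] _|hv]; last first.
    by apply/tangentP => F hF; exact: (hv F _ hF (rep_mem P) (rep_neq0 P)).
  rewrite -/(mdiff F _ v) mdiff_pihomog big1 // => k _.
  by rewrite (homog_mdiff_scale _ _ _ (pihomogP _ _ _)) hv ?mulr0 //; exact: vi_pihomog.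
split=> [[TP [W [dW hW]]]|[TP dT]]; split=> //; last by exists (tangent T P).
rewrite -dW; congr (\dim _); apply/vspaceP => v; apply/idP/idP.
  by move=> /key /hW.
by move=> /hW /key.
Qed.

Section PointIdeal.
Variables (P : psp) (p : 'I_n.+1).
Local Notation u := (rep P).
Hypothesis up : u 0 p != 0.

(** The 2 x 2 minors of the matrix with rows u and X that involve column p;
    they generate the ideal of the point P. *)
Definition minor_form (j : 'I_n.+1) : R := u 0 p *: 'X_j - u 0 j *: 'X_p.

Lemma minor_formE j : minor_form j = linform (u 0 p *: delta_mx 0 j - u 0 j *: delta_mx 0 p).
Proof.
rewrite /linform; under eq_bigr => i _ do
  rewrite !mxE !eqxx /= scalerBl -!scalerA.
rewrite sumrB -!scaler_sumr (bigD1 j) //= [X in _ *: (_ + X)]big1 => [|i /negPf ->];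
  last by rewrite scale0r.
rewrite (bigD1 p) //= [X in _ - _ *: (_ + X)]big1 => [|i /negPf ->];
  last by rewrite scale0r.
by rewrite !eqxx !scale1r !addr0.
Qed.

Lemma minor_form_eval j v : (minor_form j).@[v 0] = u 0 p * v 0 j - u 0 j * v 0 p.
Proof. by rewrite mevalB !mevalZ !mevalXU. Qed.

Lemma mdiff_minor_form j v w : mdiff (minor_form j) w v = u 0 p * v 0 j - u 0 j * v 0 p.
Proof. by rewrite minor_formE mdiff_linform -minor_formE minor_form_eval. Qed.

Lemma minor_formp : minor_form p = 0.
Proof. by rewrite /minor_form subrr. Qed.

(** Modulo the minors, X_j is a multiple of X_p, so a form of degree d is a
    multiple of X_p ^+ d. *)
Definition pt_reduced d F := exists (c : K) (G : 'I_n.+1 -> R),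
  F = c *: 'X_p ^+ d + \sum_j minor_form j * G j.

Lemma pt_reducedD d F G : pt_reduced d F -> pt_reduced d G -> pt_reduced d (F + G).
Proof.
move=> [c [E ->]] [c' [E' ->]]; exists (c + c'), (fun j => E j + E' j).
rewrite scalerDl addrACA -big_split; congr (_ + _).
by apply: eq_bigr => j _; rewrite mulrDr.
Qed.

Lemma pt_reducedZ d a F : pt_reduced d F -> pt_reduced d (a *: F).
Proof.
move=> [c [E ->]]; exists (a * c), (fun j => a *: E j).
rewrite scalerDr scalerA scaler_sumr; congr (_ + _).
by apply: eq_bigr => j _; rewrite -scalerAr.
Qed.

Lemma pt_reduced_mulX d i F : pt_reduced d F -> pt_reduced d.+1 ('X_i * F).
Proof.
move=> [c [E hF]]; exists (u 0 i / u 0 p * c),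
  (fun j => 'X_i * E j + (j == i)%:R *: (c / u 0 p *: 'X_p ^+ d)).
under eq_bigr => j _ do rewrite mulrDr mulrCA.
rewrite big_split /= -mulr_sumr hF mulrDr [RHS]addrCA [LHS]addrC; congr (_ + _).
rewrite (bigD1 i) //= big1 => [|j /negPf ->]; last by rewrite scale0r mulr0.
rewrite eqxx scale1r addr0 /minor_form mulrBl -!scalerAl -!scalerAr !scalerA -exprS.
have -> : u 0 p * (c / u 0 p) = c by rewrite mulrCA divff // mulr1.
have -> : u 0 i * (c / u 0 p) = u 0 i / u 0 p * c by rewrite mulrCA mulrC -mulrA mulrCA mulrA.
by rewrite addrC subrK.
Qed.

Lemma pt_reducedX d (m : 'X_{1..n.+1}) : mdeg m = d -> pt_reduced d 'X_[m].
Proof.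
elim: d m => [|d IH] m dm.
  have /eqP -> : m == 0%MM by rewrite -mdeg_eq0 dm.
  exists 1, (fun=> 0); rewrite mpolyX0 expr0 scale1r big1 ?addr0 // => j _.
  by rewrite mulr0.
have [i mi] : exists i, m i != 0%N.
  apply/existsP; rewrite -negb_forall; apply/negP => /forallP h.
  by move: dm; rewrite mdegE big1 // => i _; apply/eqP/h.
have Um : (U_(i) <= m)%MM by rewrite lep1mP.
have := submK Um; rewrite addmC => E.
rewrite -E mpolyXD; apply/pt_reduced_mulX/IH.
by have := congr1 (@mdeg _) E; rewrite mdegD mdeg1 dm add1n => -[].
Qed.

Lemma pt_reduced_homog d F : F \is d.-homog -> pt_reduced d F.
Proof.
move=> /dhomogP hF; rewrite [F]mpolyE big_seq; elim/big_ind: _.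
- exists 0, (fun=> 0); rewrite scale0r big1 ?addr0 // => j _; exact: mulr0.
- by move=> *; exact: pt_reducedD.
by move=> m /hF dm; apply/pt_reducedZ/pt_reducedX.
Qed.

Lemma minor_form_rep j : (minor_form j).@[u 0] = 0.
Proof. by rewrite minor_form_eval mulrC subrr. Qed.

Lemma point_ideal F : vanishes_at F P ->
  exists G : 'I_n.+1 -> R, F = \sum_j minor_form j * G j.
Proof.
move=> hF; have {}hF : vanishing_ideal [set P] F by move=> Q ->.
rewrite [F]mpoly_pihomog; elim/big_ind: _ => [|F1 F2 [G1 ->] [G2 ->]|k _].
- by exists (fun=> 0); rewrite big1 // => j _; rewrite mulr0.
- exists (fun j => G1 j + G2 j); rewrite -big_split.
  by apply: eq_bigr => j _; rewrite mulrDr.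
have [c [G E]] := pt_reduced_homog (pihomogP mdeg k F).
have := vi_pihomog k hF erefl (rep_mem P).
rewrite E mevalD mevalZ meval_exp mevalXU raddf_sum big1 => [|j _] /=; last first.
  by rewrite mevalM minor_form_rep mul0r.
rewrite addr0 => /eqP; rewrite mulf_eq0 expf_eq0 (negPf up) andbF orbF => /eqP ->.
by exists G; rewrite scale0r add0r.
Qed.

Lemma point_of_minors Q : (forall j, (minor_form j).@[rep Q 0] = 0) -> Q = P.
Proof.
move=> h; apply: point_inj; rewrite val_rep; apply/vlineP.
exists (rep Q 0 p / u 0 p); apply/rowP => j; rewrite mxE.
have /eqP := h j; rewrite minor_form_eval subr_eq0 => /eqP E.
by apply: (mulfI up); rewrite E; field.
Qed.

End PointIdeal.

Lemma pihomog_mulr F G d e : G \is e.-homog ->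
  pihomog mdeg (d + e) (F * G) = pihomog mdeg d F * G.
Proof.
move=> hG; rewrite [F in pihomog _ _ (F * _)](@pihomog_partitionE _ _ mdeg (maxn d.+1 (msize F)));
  last exact: leq_maxr.
have lt : (d < maxn d.+1 (msize F))%N by rewrite leq_max ltnSn.
rewrite mulr_suml raddf_sum (bigD1 (Ordinal lt)) //= big1 ?addr0.
  by rewrite pihomog_dE //; apply: dhomogM => //; exact: pihomogP.
move=> k kd; apply: (@pihomog_ne0 _ _ _ (k + e)%N).
  by rewrite eqn_add2r; apply: contraNneq kd => E; apply/eqP/val_inj.
by apply: dhomogM => //; exact: pihomogP.
Qed.

(** Nakayama's argument, made explicit by a determinant.  If the tangent space
    were a line, each of the forms L j generating the ideal of P would be the
    linear part at P of some F j in the ideal of C.  Writing F = M L gives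
    det M * L j in the ideal of C with det M nonzero at P; the ideal being
    prime, all L j vanish on C, and C is the point P. *)
Lemma tangent_ge2 C P : zariski_irreducible C -> two_points C -> C P ->
  (1 < \dim (tangent C P))%N.
Proof.
move=> irr nt CP; rewrite ltnNge; apply/negP => le1.
have tanu : tangent C P = <[rep P]>%VS.
  apply/eqP; rewrite eq_sym eqEdim -memvE rep_tangent //=.
  by rewrite dim_vline rep_neq0.
have [p up] := rep_coord P.
set u := rep P in tanu up; pose L := minor_form P p.
have [D hD] : exists D : {vspace vec}, forall a, a \in D <->
    exists2 F, vanishing_ideal C F & forall v, mdiff F u v = (linform a).@[v 0].
  apply: ex_vspace => [|b x y [F hF Fx] [G hG Gy]].
    exists 0; first exact: vi0.
    by move=> v; rewrite mdiff0 linform_evalE big1 // => i _; rewrite mxE mul0r.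
  exists (b *: F + G); first by apply: viD => //; exact: viZ.
  move=> v; rewrite mdiffD mdiffZ Fx Gy !linform_evalE mulr_sumr -big_split.
  by apply: eq_bigr => i _; rewrite !mxE mulrDl mulrA.
have grad F : vanishing_ideal C F -> \row_i (F^`M(i)).@[u 0] \in D.
  move=> hF; apply/hD; exists F => // v; rewrite linform_evalE.
  by apply: eq_bigr => i _; rewrite mxE.
have hL j : exists F, vanishing_ideal C F /\ forall v, mdiff F u v = (L j).@[v 0].
  pose b : vec := u 0 p *: delta_mx 0 j - u 0 j *: delta_mx 0 p.
  have Lb : L j = linform b by rewrite /L minor_formE.
  have [/hD [F hF Fb]|nb] := boolP (b \in D); first by exists F; split=> // v; rewrite Lb.
  have [v v1 v0] := sep_linform nb.
  have sym (x y : vec) : (linform x).@[y 0] = (linform y).@[x 0].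
    by rewrite !linform_evalE; apply: eq_bigr => i _; rewrite mulrC.
  have : v \in tangent C P.
    apply/tangentP => F /grad /v0; rewrite sym linform_evalE => E; rewrite -[RHS]E.
    by apply: eq_bigr => i _; rewrite mxE.
  rewrite tanu => /vlineP [c E]; move: v1.
  rewrite sym -Lb E minor_form_eval !mxE.
  rewrite (_ : _ - _ = 0) => [/eqP|]; first by rewrite eq_sym oner_eq0.
  by rewrite -/u; ring.
have [F hF] := choice hL.
have [FC Fd] : (forall j, vanishing_ideal C (F j)) /\
    (forall j v, mdiff (F j) u v = (L j).@[v 0]) by split=> j; have [] := hF j.
have hG j : exists G : 'I_n.+1 -> R, F j = \sum_k L k * G k.
  exact: (point_ideal up (FC j P CP)).
have [G FG] := choice hG.
(* [minor_form p] is 0, which leaves column p of M free; a unit vector there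
   makes M the identity matrix at u *)
pose M : 'M[R]_n.+1 := \matrix_(i, k) if k == p then (i == p)%:R else G i k.
pose Lc : 'cV[R]_n.+1 := \col_k L k.
have ML : M *m Lc = \col_j F j.
  apply/matrixP => i z; rewrite !mxE FG; apply: eq_bigr => k _; rewrite !mxE.
  by case: eqP => [->|_]; [rewrite /L minor_formp mul0r mulr0 | rewrite mulrC].
have detu : (\det M).@[u 0] = 1.
  rewrite -(det_map_mx (meval (u 0))) -[RHS](det1 K n.+1); congr (\det _).
  apply/matrixP => i k; rewrite !mxE; case: eqP => [->|/eqP kp]; first exact: rmorph_nat.
  have /eqP := Fd i (delta_mx 0 k).
  rewrite FG mdiff_sum.
  under eq_bigr => j _ do
    rewrite mdiffM [L j]/L minor_form_rep mul0r addr0 mdiff_minor_form.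
  rewrite minor_form_eval (bigD1 k) //= big1 => [|j jk].
    rewrite !mxE !eqxx /= (eq_sym p k) (negPf kp) !mulr0 !subr0 addr0 mulr1.
    by rewrite (inj_eq (mulfI up)) (eq_sym i k) => /eqP ->; rewrite eq_sym.
  by rewrite !mxE !eqxx /= (eq_sym p k) (negPf kp) (negPf jk) !mulr0 subr0 mul0r.
have DL k : vanishing_ideal C (\det M * L k).
  have := congr1 (mulmx (\adj M)) ML; rewrite mulmxA mul_adj_mx mul_scalar_mx.
  move=> /matrixP /(_ k 0); rewrite !mxE => ->.
  by apply: vi_sum => j _; rewrite !mxE; exact: viMl.
have [d nd] : exists d, (pihomog mdeg d (\det M)).@[u 0] != 0.
  apply: contrapT => h; move: detu; rewrite [\det M]mpoly_pihomog raddf_sum big1.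
    by move/esym/eqP; rewrite oner_eq0.
  by move=> k _ /=; apply: contrapT => /eqP nz; apply: h; exists k.
have hLk k : L k \is 1.-homog by rewrite /L minor_formE; exact: linform_homog.
have LC k : vanishing_ideal C (L k).
  apply: (irr_regular irr (pihomogP mdeg d (\det M)) _ (hLk k)).
    by move=> /(_ _ CP _ (rep_mem P)) /eqP; rewrite (negPf nd).
  by rewrite -(pihomog_mulr _ _ (hLk k)); exact: vi_pihomog.
have [Q1 [Q2 [C1 C2 /eqP]]] := nt; apply.
by rewrite (point_of_minors up (fun j => LC j Q1 C1 _ (rep_mem _)))
           (point_of_minors up (fun j => LC j Q2 C2 _ (rep_mem _))).
Qed.

Lemma ex_notin (U V : {vspace vec}) : (\dim U < \dim V)%N -> exists2 v, v \in V & v \notin U.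
Proof.
move=> lt; apply: contrapT => h; move: lt; rewrite ltnNge dimvS //.
by apply/subvP => v vV; apply/negPn/negP => nv; apply: h; exists v.
Qed.

(** Otherwise a hyperplane through P and r - 1 further points of C could also
    contain a tangent vector v at P.  It meets C with multiplicity at least 2 at
    P, hence r + 1 times, against Bezout's inequality in degree 1. *)
Lemma tangent_le2 C r c t0 P : zariski_irreducible C -> two_points C ->
  \dim (linspan C) = r.+1 ->
  (forall t, (t0 <= t)%N -> (hilb C t <= r * t + c)%N) ->
  C P -> (\dim (tangent C P) <= 2)%N.
Proof.
move=> irr nt dC up CP; rewrite leqNgt; apply/negP => gt2.
have r0 : (0 < r)%N by have := linspan_gt1 nt; rewrite dC.
set u := rep P; have [q [qi qC qP]] := irr_points [:: P] r.-1 irr nt.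
pose X : {vspace vec} := <<u :: [seq rep (q i) | i <- enum 'I_r.-1]>>%VS.
have dX : (\dim X < \dim (linspan C))%N.
  rewrite dC ltnS; apply: leq_trans (dim_span _) _.
  by rewrite /= size_map size_enum_ord prednK.
have [v0 v0C v0X] := ex_notin dX.
have [a a1 aX] := sep_linform v0X; pose F := linform a.
have nF : ~ vanishing_ideal C F.
  by move=> /vi_linform /(_ v0 v0C) /eqP; rewrite a1 oner_eq0.
have Fu : F.@[u 0] = 0 by apply/aX/memv_span; rewrite inE eqxx.
have Fq i : F.@[rep (q i) 0] = 0.
  by apply/aX/memv_span; rewrite inE; apply/orP; right; apply/map_f; rewrite mem_enum.
have [v [vT Fv vu]] : exists v, [/\ v \in tangent C P, F.@[v 0] = 0 & v \notin <[u]>%VS].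
  have d1 : (\dim <[u]> < \dim (tangent C P))%N.
    by rewrite dim_vline (leq_ltn_trans _ gt2) // (leq_trans (leq_b1 _)).
  have [v1 v1T v1u] := ex_notin d1.
  have [F1|F1] := eqVneq F.@[v1 0] 0; first by exists v1.
  have d2 : (\dim (<[u]> + <[v1]>) < \dim (tangent C P))%N.
    apply: leq_ltn_trans gt2; apply: leq_trans (dimv_add_leqif _ _) _.
    by rewrite !dim_vline; do 2!case: (_ == _).
  have [v2 v2T v2u] := ex_notin d2.
  exists (v2 - (F.@[v2 0] / F.@[v1 0]) *: v1); split.
  - by rewrite memvB ?memvZ.
  - have lin b (x y : vec) : F.@[(x - b *: y) 0] = F.@[x 0] - b * F.@[y 0].
      rewrite !linform_evalE mulr_sumr -sumrB; apply: eq_bigr => i _.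
      by rewrite !mxE; ring.
    by rewrite lin mulfVK // subrr.
  apply: contra v2u => h; rewrite -[v2](subrK ((F.@[v2 0] / F.@[v1 0]) *: v1)).
  by apply: memv_add => //; rewrite memvZ // memv_line.
have [b b1 bu] := sep_linform vu; have {}bu : (linform b).@[u 0] = 0.
  exact/bu/memv_line.
have [l l1] := unit_linform P.
have [|E [hE E1 E0]] := @sep_form _ _ P [seq q i | i <- enum 'I_r.-1].
  by apply/mapP => -[i _ /esym Ei]; have := qP i; rewrite Ei inE eqxx.
rewrite size_map size_enum_ord in hE.
have {}E0 i : E.@[rep (q i) 0] = 0 by apply/E0/map_f; rewrite mem_enum.
suff grow t : (r <= t)%N -> (hilb C t + r.+1 <= hilb C (1 + t))%N.
  by have := slope_bound up grow; rewrite muln1 ltnn.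
move=> rt; have rt1 : (r.-1 <= 1 + t)%N by lia.
have [D [hD Dq]] := dual_forms qi rt1.
(* Dual to the values at the q i, the value at P and the derivative along v *)
pose wf (k : 'I_r.-1 + bool) : R := match k with
  | inl i => D i
  | inr true => E * linform l ^+ (1 + t - r.-1)
  | inr false => E * linform l ^+ (t - r.-1) * linform b end.
have -> : r.+1 = #|{: 'I_r.-1 + bool}| by rewrite card_sum card_ord card_bool; lia.
apply: (@hilb_grow _ _ C F _ _ _ wf).
- exact: linform_homog.
- by move=> G; apply: irr_regular => //; exact: linform_homog.
- case=> [i|[]] //=.
    have := dhomogM hE (homogX1 (1 + t - r.-1) (linform_homog l)).
    by rewrite subnKC.
  have := dhomogM (dhomogM hE (homogX1 (t - r.-1) (linform_homog l))) (linform_homog b).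
  by rewrite subnKC ?addn1 // (leq_trans (leq_pred r)).
move=> x G _ hx.
have xl i : x (inl i) = 0.
  have := hx _ (qC i) _ (rep_mem _).
  rewrite big_sumType /= big_bool /= !mevalD mevalM Fq mul0r addr0.
  rewrite !mevalZ !mevalM E0 !mul0r !mulr0 !addr0 raddf_sum (bigD1 i) //= big1.
    by rewrite addr0 mevalZ Dq eqxx mulr1.
  by move=> j ji; rewrite mevalZ Dq (negPf ji) mulr0.
have Ex : \sum_k x k *: wf k = x (inr true) *: wf (inr true) +
    x (inr false) *: wf (inr false).
  rewrite big_sumType big_bool /= big1 ?add0r // => i _.
  by rewrite xl scale0r.
rewrite {}Ex in hx.
have xt : x (inr true) = 0.
  have := hx _ CP _ (rep_mem _); rewrite !mevalD !mevalZ !mevalM !meval_exp -/u.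
  by rewrite Fu bu E1 l1 !expr1n !mul1r !mulr1 !mulr0 mul0r !addr0.
have xf : x (inr false) = 0.
  have := (tangentP _ _ _).1 vT _ hx; rewrite xt scale0r add0r -/u.
  rewrite mdiffD mdiffZ !mdiffM !mdiff_linform Fv Fu bu b1 !mevalM meval_exp l1 E1.
  by rewrite expr1n mulr0 add0r !mul0r !mul1r !addr0 mulr1.
by case=> [i|[]].
Qed.

End TangentSpaces.

(** * First-order interpolation from the vanishing of h^1 *)

Section DoublePoints.
Variables (K : closedFieldType) (n : nat).
Local Notation R := {mpoly K[n.+1]}.
Local Notation vec := 'rV[K]_n.+1.
Local Notation psp := (pspace K n).
Local Notation FR := {fraction R}.
Local Notation tofrac := (@FracField.tofrac R).
Implicit Types (F G : R) (u v w : vec) (P Q : psp) (S : {fset psp}).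

Definition double_zero u F := F.@[u 0] = 0 /\ forall v, mdiff F u v = 0.

Lemma double_zeroM u F G : F.@[u 0] = 0 -> G.@[u 0] = 0 -> double_zero u (F * G).
Proof.
move=> hF hG; split=> [|v]; first by rewrite mevalM hF mul0r.
by rewrite mdiffM hF hG mulr0 mul0r addr0.
Qed.

Lemma double_zeroD u F G : double_zero u F -> double_zero u G -> double_zero u (F + G).
Proof.
by move=> [F0 F1] [G0 G1]; split=> [|v]; rewrite ?mevalD ?mdiffD ?F0 ?F1 ?G0 ?G1 addr0.
Qed.

Lemma double_zero_mulr u F G : double_zero u F -> double_zero u (F * G).
Proof.
move=> [F0 F1]; split=> [|v]; first by rewrite mevalM F0 mul0r.
by rewrite mdiffM F0 F1 !mul0r addr0.
Qed.

Lemma double_zero_mull u F G : double_zero u F -> double_zero u (G * F).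
Proof. by rewrite mulrC; exact: double_zero_mulr. Qed.

Lemma double_zero_cancel u F G : G.@[u 0] != 0 -> double_zero u (G * F) -> double_zero u F.
Proof.
move=> Gu [/eqP]; rewrite mevalM mulf_eq0 (negPf Gu) => /eqP F0 F1; split=> // v.
have /eqP := F1 v; rewrite mdiffM F0 mulr0 add0r mulf_eq0 (negPf Gu).
by move=> /eqP.
Qed.

Lemma ideal_square_double (A : set psp) P F : A P ->
  ideal_square (vanishing_ideal A) F -> double_zero (rep P) F.
Proof.
move=> AP [s [hs ->]]; rewrite big_seq; elim/big_ind: _ => [||[F1 F2] /hs [/= h1 h2]].
- by split=> [|v]; rewrite ?meval0 ?mdiff0.
- by move=> *; exact: double_zeroD.
by apply: double_zeroM; [apply: (h1 P AP) | apply: (h2 P AP)]; exact: rep_mem.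
Qed.

Lemma ideal_squareM (A : set psp) F G : vanishing_ideal A F -> vanishing_ideal A G ->
  ideal_square (vanishing_ideal A) (F * G).
Proof.
move=> hF hG; exists [:: (F, G)]; rewrite big_seq1; split=> // p.
by rewrite inE => /eqP ->.
Qed.

Lemma ideal_squareD (A : set psp) F G : ideal_square (vanishing_ideal A) F ->
  ideal_square (vanishing_ideal A) G -> ideal_square (vanishing_ideal A) (F + G).
Proof.
move=> [s [hs ->]] [t [ht ->]]; exists (s ++ t); rewrite big_cat; split=> // p.
by rewrite mem_cat => /orP [/hs|/ht].
Qed.

Lemma ideal_square_mull (A : set psp) F G : ideal_square (vanishing_ideal A) F ->
  ideal_square (vanishing_ideal A) (G * F).
Proof.
move=> [s [hs ->]]; exists [seq (G * p.1, p.2) | p <- s]; split.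
  by move=> p /mapP [q /hs [h1 h2] ->]; split=> //=; exact: viMl.
by rewrite big_map mulr_sumr; apply: eq_bigr => p _; rewrite mulrA.
Qed.

Lemma mpolyX_coprime F G (i j : 'I_n.+1) a b : i != j ->
  F * 'X_j ^+ b = G * 'X_i ^+ a -> exists H, F = H * 'X_i ^+ a.
Proof.
move=> ij E; exists (\sum_(m <- msupp F) F@_m *: 'X_[m - U_(i) *+ a]).
rewrite mulr_suml {1}[F]mpolyE big_seq [RHS]big_seq; apply: eq_bigr => m mF.
rewrite -scalerAl mpolyXn -mpolyXD submK //.
have : (U_(j) *+ b + m)%MM \in msupp (G * 'X_i ^+ a).
  by rewrite -E mcoeff_msupp mpolyXn mcoeffMX -mcoeff_msupp.
rewrite mpolyXn (perm_mem (msuppMX _ _)) => /mapP [m' _ /mnmP /(_ i)].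
rewrite !mnmDE !mulmnE !mnm1E eqxx mul1n (eq_sym j) (negPf ij) mul0n add0n => Em.
apply/mnm_lepP => k; rewrite mulmnE mnm1E; case: eqP => [<-|_]; last by rewrite mul0n.
by rewrite mul1n Em leq_addr.
Qed.

Lemma mulX_homog F (i : 'I_n.+1) a d : F * 'X_i ^+ a \is (d + a).-homog -> F \is d.-homog.
Proof.
move=> /dhomogP h; apply/dhomogP => m; rewrite mcoeff_msupp -(mcoeffMX _ (U_(i) *+ a)).
rewrite -mpolyXn -mcoeff_msupp => /h /=.
by rewrite mdegD mdegMn mdeg1 mul1n addnC => /addIn ->.
Qed.

Lemma binomial_first_order (T : comPzRingType) (a b : T) k :
  exists h, (a + b) ^+ k.+1 = a ^+ k.+1 + (a ^+ k * b) *+ k.+1 + b ^+ 2 * h.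
Proof.
elim: k => [|k [h IH]]; first by exists 0; rewrite !expr1 expr0; ring.
exists (h * (a + b) + a ^+ k *+ k.+1); rewrite exprS IH.
by rewrite (exprS a k.+1) (exprS a k); ring.
Qed.

(** Both terms on the right have a double zero where m vanishes and D = l: there
    2 l - D inverts D up to l ^ 2 to first order, as
    D (2 l - D) = l ^ 2 - (D - l) ^ 2. *)
Lemma jet_identity (T : comPzRingType) (w D l y m h : T) :
  w * (D ^+ 2 * ((l *+ 2 - D) ^+ 2 * y)) - w * (l ^+ 4 * y + m ^+ 2 * h) =
  - w * (m * m * h) + w * ((D - l) * (D - l) * (((D - l) ^+ 2 - l ^+ 2 *+ 2) * y)).
Proof. ring. Qed.

Lemma cocycle_identity (T : comPzRingType) (w D q l y y' m m' h h' : T) :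
  w * (D ^+ 2 * (q ^+ 2 * y)) * (l * y' + m' ^+ 2 * h') -
  w * (D ^+ 2 * (q ^+ 2 * y')) * (l * y + m ^+ 2 * h) =
  (w * q ^+ 2 * y * h') * ((D * m') * (D * m')) +
  (- w * q ^+ 2 * y' * h) * ((D * m) * (D * m)).
Proof. ring. Qed.

Lemma div_sub (F : fieldType) (a b x y : F) : x != 0 -> y != 0 ->
  b / y - a / x = (b * x - a * y) / (x * y).
Proof. by move=> x0 y0; field; rewrite y0 x0. Qed.

Section LocalToGlobal.
Variables (S : {fset psp}) (d : nat) (P0 : psp) (W : R).
Hypotheses (hW : W \is d.-homog) (SP0 : P0 \in S).
Local Notation J := (double_ideal S).
Local Notation u0 := (rep P0).

(** The fractions F i / X_i ^ N are local sections of O(d) that agree with W to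
    first order at P0 and vanish doubly at the other points of S.  The factor
    D ^ 2 with D vanishing on S minus P0 provides the double zeros, q ^ 2
    inverts it to first order at P0, and Y i replaces X_i ^ N there up to a
    power of L.  With these choices each cross difference is visibly in the
    square of the ideal of S. *)
Lemma local_sections : exists (N : nat) (F : 'I_n.+1 -> R),
  [/\ forall i, F i \is (d + N).-homog,
      forall i, double_zero u0 (F i - W * 'X_i ^+ N),
      forall i P, P \in S -> P != P0 -> double_zero (rep P) (F i)
    & forall i j, J (F i * 'X_j ^+ N - F j * 'X_i ^+ N)].
Proof.
have [l l1] := unit_linform P0; pose L := linform l.
have [|D [hD D1 D0]] := @sep_form _ _ P0 [seq P <- enum_fset S | P != P0].
  by rewrite mem_filter eqxx.
set e := size _ in hD.
have {}D0 P : P \in S -> P != P0 -> D.@[rep P 0] = 0.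
  by move=> PS PP0; apply: D0; rewrite mem_filter PP0.
(* X_i ^ N is L ^ (4 e) times a linear form to first order, and D ^ 2 q ^ 2 is
   L ^ (4 e) to first order *)
pose N := (4 * e).+1.
pose c i := u0 0 i; pose m i : R := 'X_i - c i *: L.
have m0 i : (m i).@[u0 0] = 0 by rewrite mevalB mevalXU mevalZ l1 mulr1 subrr.
have hL : L \is 1.-homog by exact: linform_homog.
have hX i : ('X_i : R) \is 1.-homog by rewrite dhomogX /= mdeg1.
have hm i : m i \is 1.-homog by rewrite rpredB ?rpredZ.
pose Y i : R := (c i ^+ N) *: L + ((c i ^+ (4 * e)) *: m i) *+ N.
have hY i : Y i \is 1.-homog by rewrite rpredD ?rpredMn ?rpredZ.
have XH' i : exists H, 'X_i ^+ N = L ^+ (4 * e) * Y i + m i ^+ 2 * H.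
  have [H] := binomial_first_order (c i *: L) (m i) (4 * e); exists H.
  rewrite -[in LHS](subrK (c i *: L) 'X_i) addrC -/(m i) p; congr (_ + _).
  by rewrite /Y [RHS]mulrDr mulrnAr -!scalerAr !exprZn -scalerAl (exprSr L).
have [H XH] := choice XH'.
pose q := L ^+ e *+ 2 - D.
pose Z i := q ^+ 2 * Y i.
have hq : q \is e.-homog.
  by rewrite rpredB // rpredMn // homogX1.
have hDS i : vanishing_ideal [set` S] (D * m i).
  apply/(vi_homogP _ (dhomogM hD (hm i))) => P PS; rewrite mevalM.
  by have [->|/(D0 P PS) ->] := eqVneq P P0; rewrite ?m0 ?mulr0 ?mul0r.
exists N, (fun i => W * (D ^+ 2 * Z i)); split=> i.
- have -> : (d + N = d + (e * 2 + (e * 2 + 1)))%N by rewrite /N; lia.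
  by apply/dhomogM => //; apply/dhomogM/dhomogM/hY; exact: homogX.
- have -> : W * (D ^+ 2 * Z i) - W * 'X_i ^+ N =
      - W * ((m i * m i) * H i) +
      W * (((D - L ^+ e) * (D - L ^+ e)) * (((D - L ^+ e) ^+ 2 - (L ^+ e) ^+ 2 *+ 2) * Y i)).
    have L4 : L ^+ (4 * e) = (L ^+ e) ^+ 4 by rewrite mulnC exprM.
    by rewrite XH /Z /q L4 jet_identity.
  apply: double_zeroD; apply/double_zero_mull/double_zero_mulr/double_zeroM => //;
    by rewrite mevalB meval_exp D1 l1 expr1n subrr.
- move=> P PS PP0; apply/double_zero_mull/double_zero_mulr.
  by apply: double_zeroM; exact: D0.
move=> j; rewrite !XH.
rewrite /Z cocycle_identity.
by apply: ideal_squareD; apply/ideal_square_mull/ideal_squareM.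
Qed.

(** A cocycle that is not a coboundary is independent modulo coboundaries,
    since these are stable under scaling. *)
Lemma coboundary_of_cocycle c : ~ cohom_dim_ge 1 J d 1 -> @cocycles K n J d 1 c ->
  @coboundaries K n J d 1 c.
Proof.
move=> h1 hc; apply: contrapT => nb; apply: h1.
exists (fun=> c); split=> // a; rewrite big_ord1 => -[b hb E] i.
rewrite (ord1 i); apply: contrapT => /eqP a0; apply: nb.
exists (cochain_scale (a ord0)^-1 b).
  move=> t; have [N [F [JF hF bt]]] := hb t.
  exists N, ((a ord0)^-1 *: F); split.
  - by rewrite -mul_mpolyC; exact: ideal_square_mull.
  - by rewrite rpredZ.
  by rewrite ffunE bt -mul_mpolyC tofracM mulrA.
have /ffunP /= {}E := E; apply/ffunP => t; have := E t; rewrite !ffunE => Et.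
under eq_bigr => k _ do rewrite ffunE mulrCA.
rewrite -mulr_sumr -Et mulrA -tofracM -mpolyCM mulVf //.
by rewrite tofrac1 mul1r.
Qed.

Lemma section_eq (a b x y : R) : x != 0 -> y != 0 ->
  tofrac a / tofrac x = tofrac b / tofrac y -> a * y = b * x.
Proof.
move=> x0 y0 /eqP; rewrite eqr_div ?tofrac_eq0 // -!tofracM tofrac_eq => /eqP.
by [].
Qed.

(** The differences of the local sections form a 1-cocycle of the ideal sheaf
    of the double points.  Subtracting from each the section given by a bounding
    cochain, which has zero 1-jet at S, makes them agree; the common fraction has
    powers of two different variables as denominators, so it is a polynomial. *)
Lemma double_jet_lift : (0 < n)%N -> ~ cohom_dim_ge 1 J d 1 ->
  exists g, [/\ g \is d.-homog, double_zero u0 (g - W) &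
    forall P, P \in S -> P != P0 -> double_zero (rep P) g].
Proof.
move=> n0 h1; have [N [F [hF FW F0 FJ]]] := local_sections.
pose X i : R := 'X_i; have X0 i k : X i ^+ k != 0.
  by rewrite expf_neq0 // /X -msupp_eq0 msuppX.
pose f i : FR := tofrac (F i) / tofrac (X i) ^+ N.
pose c : {ffun 2.-tuple 'I_n.+1 -> FR} := [ffun t => f (tnth t 1) - f (tnth t 0)].
have [|b hb Ec] := @coboundary_of_cocycle c h1.
  split=> [t|].
    exists N, (F (tnth t 1) * X (tnth t 0) ^+ N - F (tnth t 0) * X (tnth t 1) ^+ N).
    split; first exact: FJ.
      have hX i k : X i ^+ k \is k.-homog.
        by rewrite homogX1 // dhomogX /= mdeg1.
      by rewrite muln2 -addnn addnA rpredB // dhomogM.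
    rewrite ffunE /f /xprod big_ord_recl big_ord1 /= tofracB !tofracM !tofracXn exprMn.
    have -> : lift ord0 ord0 = 1 :> 'I_2 by apply: val_inj.
    by apply: div_sub; rewrite -tofracXn tofrac_eq0.
  apply/ffunP => t; rewrite ffunE !big_ord_recl big_ord0 !ffunE.
  rewrite !tnth_mktuple.
  have -> : lift (lift ord0 (lift ord0 ord0)) (1 : 'I_2) = lift ord0 0 :> 'I_3.
    exact: val_inj.
  have -> : lift (lift ord0 (lift ord0 ord0)) (0 : 'I_2) =
      lift (lift ord0 ord0) 0 :> 'I_3 by exact: val_inj.
  have -> : lift (lift ord0 ord0) (1 : 'I_2) = lift ord0 1 :> 'I_3 by exact: val_inj.
  by rewrite expr0 expr1 sqrrN expr1n; ring.
have hb' i : exists k B, [/\ J B, B \is (d + k).-homog &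
    b [tuple i] = tofrac B / tofrac (X i) ^+ k].
  have [k [B [JB hB bE]]] := hb [tuple i]; exists k, B; split=> //.
    by move: hB; rewrite muln1.
  by rewrite bE /xprod big_ord_recl big_ord0 mulr1.
have [k /choice [B hB]] := choice hb'.
have glue i j : f i - b [tuple i] = f j - b [tuple j].
  have /ffunP /(_ [tuple i; j]) := Ec; rewrite !ffunE big_ord_recl big_ord1.
  have -> : [tuple tnth [tuple i; j] (lift ord0 j0) | j0 < 1] = [tuple j].
    by apply: eq_from_tnth => z; rewrite (ord1 z) tnth_mktuple.
  have -> : [tuple tnth [tuple i; j] (lift (lift ord0 ord0) j0) | j0 < 1] = [tuple i].
    by apply: eq_from_tnth => z; rewrite (ord1 z) tnth_mktuple.
  rewrite expr0 expr1 mul1r mulN1r => E0.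
  have E : f j - f i = b [tuple j] - b [tuple i] by exact: E0.
  by rewrite -(subrK (f i) (f j)) E; ring.
pose num i := F i * X i ^+ k i - B i * X i ^+ N.
pose M i := (N + k i)%N.
have numE i : f i - b [tuple i] = tofrac (num i) / tofrac (X i ^+ M i).
  have [_ _ ->] := hB i; rewrite /f /num div_sub -?tofracXn ?tofrac_eq0 //.
  by rewrite -!tofracM -tofracB -exprD addnC.
have cross i j : num i * X j ^+ M j = num j * X i ^+ M i.
  apply: section_eq; [exact: X0 | exact: X0 | rewrite -!numE; exact: glue].
have i01 : ord0 != ord_max :> 'I_n.+1 by rewrite -val_eqE /= eq_sym -lt0n.
(* The common fraction has no pole along X_0 = 0, being regular where the last
   variable is invertible *)
have [g hg] := mpolyX_coprime i01 (cross ord0 ord_max).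
have {}hg i : num i = g * X i ^+ M i.
  apply: (mulIf (X0 ord0 (M ord0))); rewrite cross hg; exact: mulrAC.
have jet i P : P \in S -> double_zero (rep P) (X i ^+ M i * g - X i ^+ k i * F i).
  move=> PS; have -> : X i ^+ M i * g - X i ^+ k i * F i = - X i ^+ N * B i.
    have gen (f' x b' y : R) : f' * x - b' * y - x * f' = - y * b' by ring.
    by rewrite mulrC -hg gen.
  apply/double_zero_mull; apply: (@ideal_square_double [set` S]) => //.
  by have [] := hB i.
have Xrep i P m : rep P 0 i != 0 -> (X i ^+ m).@[rep P 0] != 0.
  by move=> h; rewrite meval_exp mevalXU expf_neq0.
exists g; split.
- apply: (@mulX_homog _ ord0 (M ord0)); rewrite -hg /num.
  have hX i m : X i ^+ m \is m.-homog by rewrite homogX1 // dhomogX /= mdeg1.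
  have [_ hBi _] := hB ord0.
  rewrite rpredB // addnA; first exact: dhomogM.
  by rewrite addnAC; exact: dhomogM.
- have [i ui] := rep_coord P0; apply: (double_zero_cancel (Xrep i P0 (M i) ui)).
  have -> : X i ^+ M i * (g - W) = (X i ^+ M i * g - X i ^+ k i * F i) +
      X i ^+ k i * (F i - W * X i ^+ N).
    have gen (x y f' w g' : R) : x * y * (g' - w) =
      (x * y * g' - y * f') + y * (f' - w * x) by ring.
    by rewrite /M exprD (gen _ _ (F i)).
  by apply: double_zeroD; [exact: jet | exact: double_zero_mull].
move=> P PS PP0; have [i ui] := rep_coord P.
apply: (double_zero_cancel (Xrep i P (M i) ui)).
rewrite -[_ * g](subrK (X i ^+ k i * F i)); apply: double_zeroD; first exact: jet.
exact/double_zero_mull/F0.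
Qed.

End LocalToGlobal.
End DoublePoints.

(** * Conditions imposed by double points on a curve *)

Section Counting.
Variables (K : closedFieldType) (n : nat).
Local Notation R := {mpoly K[n.+1]}.
Local Notation vec := 'rV[K]_n.+1.
Local Notation psp := (pspace K n).
Implicit Types (F G : R) (u v w : vec) (P Q : psp).

(** At each point P of A the value and the derivative along a tangent vector of
    B kill the ideal of B.  These 2 #A functionals are independent in degree d,
    because forms with prescribed 1-jets at A exist. *)
Lemma hilb_double_points (A : {fset psp}) (B : set psp) d : (0 < n)%N -> (0 < d)%N ->
  ~ cohom_dim_ge 1 (double_ideal A) d 1 -> [set` A] `<=` B ->
  (forall P, P \in A -> (1 < \dim (tangent B P))%N) ->
  (2 * #|` A| <= hilb B d)%N.
Proof.
move=> n0 d0 h1 AB tan2.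
have h (P : A) : exists v (W : bool -> R), [/\ v \in tangent B (val P),
    forall b, W b \is d.-homog,
    forall b, (W b).@[rep (val P) 0] = b%:R
    & mdiff (W false) (rep (val P)) v = 1].
  set u := rep (val P).
  have d1 : (\dim <[u]> < \dim (tangent B (val P)))%N.
    by apply: leq_ltn_trans (tan2 _ (valP P)); rewrite dim_vline leq_b1.
  have [v vT vu] := ex_notin d1; exists v.
  have uv : u \notin <[v]>%VS.
    apply: contra vu => /vlineP [c E]; apply/vlineP; exists c^-1.
    have c0 : c != 0.
      by apply: contraTneq (rep_neq0 (val P)) => c0; rewrite -/u E c0 scale0r eqxx.
    by rewrite E scalerA mulVf // scale1r.
  have [l l1 l0] := sep_linform uv; have [w w1 w0] := sep_linform vu.
  have {}l0 := l0 v (memv_line v); have {}w0 := w0 u (memv_line u).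
  exists (fun b => if b then linform l ^+ d else linform l ^+ d.-1 * linform w).
  split=> // [[|]|[|]|].
  - exact/homogX1/linform_homog.
  - by have := dhomogM (homogX1 d.-1 (linform_homog l)) (linform_homog w);
      rewrite addn1 prednK.
  - by rewrite meval_exp l1 expr1n.
  - by rewrite mevalM w0 mulr0.
  by rewrite mdiffM w0 mulr0 add0r meval_exp l1 expr1n mul1r mdiff_linform.
have [v /choice [W hW]] := choice h.
have hg (k : A * bool) : exists g, [/\ g \is d.-homog,
    double_zero (rep (val k.1)) (g - W k.1 k.2) &
    forall P, P \in A -> P != val k.1 -> double_zero (rep P) g].
  by apply: double_jet_lift => //; [have [_ + _ _] := hW k.1; apply | exact: valP].
have [g gP] := choice hg.
have -> : (2 * #|` A| = #|{: A * bool}|)%N by rewrite card_prod card_bool cardfE mulnC.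
apply: (@leq_hilb _ _ _ _ _ g) => [k|a ha]; first by case: (gP k).
have aval (f : R -> K) (P : A) : f 0 = 0 -> (forall c F G, f (c *: F + G) = c * f F + f G) ->
    (forall G, double_zero (rep (val P)) G -> f G = 0) -> 
    f (\sum_k a k *: g k) = a (P, true) * f (W P true) + a (P, false) * f (W P false).
  move=> f0 flin fdz.
  have -> : f (\sum_k a k *: g k) = \sum_k a k * f (g k).
    by elim/big_rec2: _ => // k x y _ <-; rewrite flin.
  have -> : \sum_k a k * f (g k) = \sum_(Q : A) \sum_b a (Q, b) * f (g (Q, b)).
    by rewrite pair_bigA; apply: eq_bigr => -[Q b] _.
  rewrite (bigD1 P) //= [X in _ + X]big1.
    rewrite big_bool addr0.
    have fW b : f (g (P, b)) = f (W P b).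
      have [_ /fdz z _] := gP (P, b).
      by rewrite -(subrK (W P b) (g (P, b))) -[_ - _]scale1r flin z mulr0 add0r.
    by rewrite !fW.
  move=> Q QP; apply: big1 => b _; have [_ _ z] := gP (Q, b).
  rewrite fdz ?mulr0 //; apply: z; first exact: valP.
  by apply: contraNneq QP => /= /val_inj ->.
have at1 (P : A) : a (P, true) = 0.
  have [_ _ W1 _] := hW P.
  have := aval (meval (rep (val P) 0)) P (meval0 _).
  rewrite !W1 mulr1 mulr0 addr0 => <- //; last by move=> G [].
    by apply: (ha (val P)); [apply: AB; exact: (valP P) | exact: rep_mem].
  by move=> c F G; rewrite mevalD mevalZ.
have at0 (P : A) : a (P, false) = 0.
  have [vT _ _ W1] := hW P.
  have := aval (fun F => mdiff F (rep (val P)) (v P)) P (mdiff0 _ _).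
  rewrite W1 at1 mul0r add0r mulr1 => <- //; last by move=> G [].
    exact: ((tangentP _ _ _).1 vT _ ha).
  by move=> c F G; rewrite mdiffD mdiffZ.
by case=> P [].
Qed.

End Counting.

(** * Connected unions of components *)

Section Configuration.
Variables (K : closedFieldType) (n : nat).
Local Notation R := {mpoly K[n.+1]}.
Local Notation vec := 'rV[K]_n.+1.
Local Notation psp := (pspace K n).
Implicit Types (F G : R) (u v w : vec) (P Q : psp).

Variables (s : nat) (C : 'I_s -> set psp).
Implicit Types (i j : 'I_s) (J X : {set 'I_s}).

Definition subcurve J : set psp := [set P | exists2 i, i \in J & C i P].

Lemma subcurve_big J : \big[setU/set0]_(i in J) C i = subcurve J.
Proof.
have mem (l : seq 'I_s) P : (\big[setU/set0]_(i <- l | i \in J) C i) P <->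
    exists2 i, i \in l & i \in J /\ C i P.
  elim: l => [|j l IH]; first by rewrite big_nil; split=> // -[].
  rewrite big_cons; split.
    have [jJ [Cj|/IH [i il h]]|jJ /IH [i il h]] := boolP (j \in J).
    - by exists j; rewrite ?mem_head.
    - by exists i; rewrite // inE il orbT.
    by exists i; rewrite // inE il orbT.
  case=> i; rewrite inE => /predU1P [->|il] [iJ CP]; first by rewrite iJ; left.
  by case: ifP => _; [right|]; apply/IH; exists i.
apply/seteqP; split=> P; first by move=> /mem [i _ [iJ CP]]; exists i.
by move=> [i iJ CP]; apply/mem; exists i => //; rewrite mem_index_enum.
Qed.

Definition adjacent i j := exists2 P, C i P & C j P.

Lemma adjacent_sym i j : adjacent i j -> adjacent j i.
Proof. by case=> P; exists P. Qed.

(** Unions grown one component at a time, each meeting what is already there;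
    this is the form in which the bounds on spans and Hilbert functions
    propagate. *)
Inductive connected_union : {set 'I_s} -> Prop :=
| connected1 i : connected_union [set i]
| connectedU i j J : connected_union J -> i \in J -> j \notin J -> adjacent i j ->
    connected_union (j |: J).

Definition connected_config := forall J, J != finset.set0 -> J != [set: 'I_s]%SET ->
  exists i j, [/\ i \in J, j \notin J & adjacent i j].

(** A connected union inside X of maximal size. *)
Lemma connected_saturated X i : i \in X -> exists J,
  [/\ connected_union J, i \in J, J \subset X &
      forall a b, a \in J -> b \in X -> adjacent a b -> b \in J].
Proof.
move=> iX; pose good J := `[< [/\ connected_union J, i \in J & J \subset X] >].
have [|J /maxsetP [/asboolP [cJ iJ JX] mx]] := @ex_maxset _ good.
  exists [set i]%SET; apply/asboolP; split; rewrite ?finset.sub1set ?inE //.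
  exact: connected1.
exists J; split=> // a b aJ bX ab; apply/negPn/negP => nb.
have E : (b |: J)%SET = J; last by move: nb; rewrite -E setU11.
apply: mx (finset.subsetUr _ _); apply/asboolP; split.
- exact: connectedU ab.
- by rewrite finset.in_setU iJ orbT.
- by rewrite finset.subUset finset.sub1set bX.
Qed.

(** Let J be the part of the complement of j that can be reached from i.  What
    remains is connected: each of its pieces must be attached to j, for no piece
    is attached to J. *)
Lemma connected_split i j : connected_config -> i != j -> adjacent i j -> exists J,
  [/\ connected_union J, connected_union (~: J)%SET, i \in J & j \notin J].
Proof.
move=> conn ij mij.
have [|J [cJ iJ JX satJ]] := @connected_saturated [set~ j]%SET i; first by rewrite !inE.
have jJ : j \notin J by apply/negP => /(fintype.subsetP JX); rewrite !inE eqxx.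
have [|M [cM jM MX satM]] := @connected_saturated (~: J)%SET j; first by rewrite inE.
exists J; split=> //; suff -> : (~: J)%SET = M by [].
apply/eqP; rewrite finset.eqEsubset MX andbT -finset.setD_eq0; apply/negPn/negP => N0.
have [|a [b []]] := conn _ N0.
  by apply/negP => /eqP /setP /(_ i); rewrite !inE iJ andbF.
rewrite !inE => /andP [aM aJ]; rewrite negb_and !negbK => /orP [bM|bJ] ab.
  by case/negP: aM; apply: satM bM _ (adjacent_sym ab); rewrite inE.
case/negP: aJ; apply: satJ bJ _ (adjacent_sym ab); rewrite !inE.
by apply: contraNneq aM => ->.
Qed.

(** All curves meeting C i pass through P, so they meet each other. *)
Lemma connected_complement i P : connected_config -> (exists j, j != i) ->
  (forall j Q, j != i -> C i Q -> C j Q -> Q = P) -> connected_union (~: [set i])%SET.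
Proof.
move=> conn [k ki] uniqP.
have [||_ [j [/finset.set1P -> ]]] := conn [set i]%SET.
- by apply/negP => /eqP /setP /(_ i); rewrite !inE eqxx.
- by apply/negP => /eqP /setP /(_ k); rewrite !inE (negPf ki).
rewrite inE => ji [Q CiQ CjQ].
have CjP : C j P by rewrite -(uniqP j Q).
have [|J [cJ jJ JX satJ]] := @connected_saturated (~: [set i])%SET j; first by rewrite !inE.
suff -> : (~: [set i])%SET = J by [].
apply/eqP; rewrite finset.eqEsubset JX andbT -finset.setD_eq0; apply/negPn/negP => N0.
have [|a [b []]] := conn _ N0.
  by apply/negP => /eqP /setP /(_ i); rewrite !inE eqxx andbF.
rewrite !inE => /andP [aJ ai]; rewrite negb_and !negbK => /orP [bJ|/eqP ->] [Q' CaQ CbQ].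
  by case/negP: aJ; apply: satJ bJ _ _; rewrite ?inE //; exists Q'.
case/negP: aJ; apply: satJ jJ _ _; rewrite ?inE //.
by exists P => //; rewrite -(uniqP a Q').
Qed.

Hypotheses (irrC : forall i, zariski_irreducible (C i))
  (closedC : forall i, zariski_closed (C i))
  (ntC : forall i, two_points (C i))
  (incomparable : forall i j, i != j -> ~ C i `<=` C j)
  (connC : connected_config).
Local Notation T := (subcurve [set: 'I_s]%SET).
Variables (c0 t0 : nat).
Hypotheses (spanT : linspan T = fullv)
  (hilbT : forall t, (t0 <= t)%N -> (hilb T t <= n * t + c0)%N).

(** This projective dimension turns out to be the degree of the curve. *)
Definition rk i := (\dim (linspan (C i))).-1.

Lemma dim_linspan i : \dim (linspan (C i)) = (rk i).+1.
Proof. by rewrite /rk prednK // linspan_gt0. Qed.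

Lemma rk_gt0 i : (0 < rk i)%N.
Proof. by have := linspan_gt1 (ntC i); rewrite dim_linspan. Qed.

Lemma subcurve1 i : subcurve [set i]%SET = C i.
Proof.
apply/seteqP; split=> P; first by case=> j /finset.set1P ->.
by move=> CP; exists i => //; rewrite inE.
Qed.

Lemma subcurveU1 j J : subcurve (j |: J)%SET = C j `|` subcurve J.
Proof.
apply/seteqP; split=> P.
  by case=> i /finset.setU1P [->|iJ] CP; [left | right; exists i].
by case=> [CP|[i iJ CP]]; [exists j | exists i] => //; rewrite !inE ?eqxx ?iJ ?orbT.
Qed.

Lemma subcurve_sub i J : i \in J -> C i `<=` subcurve J.
Proof. by move=> iJ P CP; exists i. Qed.

Lemma dim_linspan_glue i j J : i \in J -> adjacent i j ->
  (\dim (linspan (subcurve (j |: J)%SET)) <= rk j + \dim (linspan (subcurve J)))%N.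
Proof.
move=> iJ [P CiP CjP]; rewrite subcurveU1 linspanU.
have := dimv_sum_cap (linspan (C j)) (linspan (subcurve J)).
have : (0 < \dim (linspan (C j) :&: linspan (subcurve J)))%N.
  rewrite lt0n dimv_eq0; apply: contraNneq (rep_neq0 P) => E.
  by rewrite -memv0 -E memv_cap !linspan_rep //; exists i.
rewrite dim_linspan; lia.
Qed.

(** Start from J and glue on the missing curves one at a time, in an order in
    which each meets the previous ones: a curve raises the dimension of the span
    by at most its rk, and in the end the span is everything. *)
Lemma dim_linspan_lower J : J != finset.set0 ->
  (n < \dim (linspan (subcurve J)) + \sum_(i in ~: J) rk i)%N.
Proof.
have [k] := ubnP #|~: J|%SET; elim: k J => // k IH J ltk J0.
have [->|JT] := eqVneq J [set: 'I_s]%SET.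
  by rewrite spanT dimvf /dim /= mul1n (leq_trans (ltnSn n)) // leq_addr.
have [i [j [iJ jJ mij]]] := connC J0 JT.
have jJ' : j \in (~: J)%SET by rewrite inE.
have E : (~: (j |: J))%SET = (~: J :\ j)%SET.
  by apply/setP => x; rewrite !inE negb_or.
have := IH (j |: J)%SET; rewrite E => /(_ _ _)-IHJ.
have {}IHJ : (n < \dim (linspan (subcurve (j |: J)%SET)) + \sum_(i in ~: J :\ j) rk i)%N.
  apply: IHJ; last by apply: contraTneq (setU11 j J) => ->; rewrite inE.
  by move: ltk; rewrite (cardsD1 j) jJ'.
apply: (leq_trans IHJ); rewrite (big_setD1 j jJ') addnA leq_add2r addnC.
exact: dim_linspan_glue iJ mij.
Qed.

(** A product of forms, each vanishing on one of the other curves. *)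
Lemma ex_separators : exists (e : 'I_s -> nat) (G : 'I_s -> R),
  [/\ forall i, G i \is (e i).-homog,
      forall i j, j != i -> vanishing_ideal (C j) (G i)
    & forall i, ~ vanishing_ideal (C i) (G i)].
Proof.
have h i : exists e G, [/\ G \is e.-homog,
    forall j, j != i -> vanishing_ideal (C j) G & ~ vanishing_ideal (C i) G].
  have hj j : exists e G, j != i -> [/\ G \is e.-homog, vanishing_ideal (C j) G
      & ~ vanishing_ideal (C i) G].
    have [->|ji] := eqVneq j i; first by exists 0%N, 0.
    have [P CiP nCj] : exists2 P, C i P & ~ C j P.
      apply: contrapT => h; apply: (@incomparable i j); first by rewrite eq_sym.
      by move=> P CiP; apply: contrapT => nj; apply: h; exists P.
    have [d [F [hF FC FP]]] := closed_sep (closedC j) nCj.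
    exists d, F => _; split=> // /(_ P CiP _ (rep_mem P)) /eqP.
    by rewrite (negPf FP).
  have [e /choice [G hG]] := choice hj.
  exists (\sum_(j | j != i) e j)%N, (\prod_(j | j != i) G j); split.
  - by apply: homog_prod_seq => j /hG [].
  - move=> j ji; rewrite (bigD1 j) //=; apply: viM.
    by have [] := hG j ji.
  by apply: (irr_prod (e := e)) => // j /hG [].
have [e /choice [G hG]] := choice h.
by exists e, G; split=> i; have [] := hG i.
Qed.

Lemma sum_rk_ge : (0 < s)%N -> (n <= \sum_i rk i)%N.
Proof.
move=> s0; pose i := Ordinal s0.
have := @dim_linspan_lower [set i]%SET; rewrite subcurve1 dim_linspan => /(_ _)-h.
have {}h : (n < (rk i).+1 + \sum_(j in ~: [set i]) rk j)%N.
  by apply: h; apply/negP => /eqP /setP /(_ i); rewrite !inE eqxx.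
rewrite (bigD1 i) //= (eq_bigl (fun j => j \in ~: [set i]%SET)) //.
by move=> j; rewrite !inE.
Qed.

Lemma sum_hilb_le : exists (E : nat) (e : 'I_s -> nat), (forall i, e i <= E)%N /\
  forall t, (E <= t)%N -> (t0 <= t)%N -> (\sum_i hilb (C i) (t - e i) <= n * t + c0)%N.
Proof.
have [e [G [hG Goff Gon]]] := ex_separators.
exists (\max_i e i)%N, e; split=> [i|t Et tt]; first exact: leq_bigmax.
have le i : (e i <= t)%N by apply: leq_trans Et; exact: leq_bigmax.
apply: leq_trans (hilbT tt).
apply: (@hilb_sum _ _ _ C T G e (fun i => t - e i)%N) => //.
- by move=> i; apply: subcurve_sub; rewrite inE.
- by move=> i F hF; exact: (irr_regular (irrC i) (hG i) (Gon i) hF).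
by move=> i; rewrite subnKC.
Qed.

(** At least n by [dim_linspan_lower]; at most n because the Hilbert functions of
    the curves, of slope at least rk i, add up to at most n t + O(1). *)
Lemma sum_rk : (0 < s)%N -> (\sum_i rk i = n)%N.
Proof.
move=> s0; apply/eqP; rewrite eqn_leq sum_rk_ge // andbT.
have [E [e [eE h]]] := sum_hilb_le.
set r := (\sum_i rk i)%N.
have low t : (E <= t)%N -> (t0 <= t)%N -> (r * t <= n * t + (c0 + r * E))%N.
  move=> Et tt; have : (\sum_i rk i * (t - E) <= \sum_i hilb (C i) (t - e i))%N.
    apply: leq_sum => i _; apply: leq_trans (hilb_lower _ (irrC i) (dim_linspan i)).
    rewrite (@leq_trans (rk i * (t - e i))) ?leq_addr //.
    by rewrite leq_mul2l leq_sub2l ?orbT.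
  rewrite -big_distrl /= -/r mulnBr => low.
  have := leq_trans low (h t Et tt); lia.
rewrite leqNgt; apply/negP => lt.
(* Large enough for a slope r > n to beat the constant c0 + r * E *)
pose t := (E + t0 + (c0 + r * E).+1)%N.
have := low t; rewrite /t => /(_ _ _)-H.
have {H} : (r * t <= n * t + (c0 + r * E))%N by apply: H; lia.
have : (n.+1 * t <= r * t)%N by rewrite leq_mul2r lt orbT.
rewrite mulSn /t; lia.
Qed.

(** Subtract from the bound on the sum the lower bounds for the other curves;
    the slopes add up to n exactly. *)
Lemma hilb_component_bound i : exists c t1, forall t, (t1 <= t)%N ->
  (hilb (C i) t <= rk i * t + c)%N.
Proof.
have s0 : (0 < s)%N := leq_ltn_trans (leq0n i) (ltn_ord i).
have [E [e [eE h]]] := sum_hilb_le.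
exists (n * E + c0)%N, (E + t0)%N => t tt.
have := h (t + e i)%N; rewrite (bigD1 i) //= addnK => /(_ _ _)-H.
have {}H : (hilb (C i) t + \sum_(j | j != i) hilb (C j) (t + e i - e j) <=
    n * (t + e i) + c0)%N by apply: H; lia.
have low : (\sum_(j | j != i) rk j * (t + e i - E) <=
    \sum_(j | j != i) hilb (C j) (t + e i - e j))%N.
  apply: leq_sum => j _; apply: leq_trans (hilb_lower _ (irrC j) (dim_linspan j)).
  by rewrite (leq_trans _ (leq_addr _ _)) // leq_mul2l leq_sub2l ?orbT.
move: low; rewrite -big_distrl /=; set q := (\sum_(j | j != i) rk j)%N => low.
have nE : n = (rk i + q)%N by rewrite -(sum_rk s0) (bigD1 i).
move: H low (eE i); set A := (\sum_(j | j != i) hilb _ _)%N; move: A => A H low ei.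
have : (q * (t + e i) <= A + q * E)%N by rewrite mulnBr in low; lia.
have : (rk i * e i <= rk i * E)%N by rewrite leq_mul2l ei orbT.
have En x : (n * x = rk i * x + q * x)%N by rewrite -mulnDl -nE.
move: H; rewrite !En !mulnDr; lia.
Qed.

Lemma hilb_component i t : hilb (C i) t = (rk i * t + 1)%N.
Proof.
have [c [t1 h]] := hilb_component_bound i.
exact: (hilb_exact t (irrC i) (ntC i) (dim_linspan i) h).
Qed.

Lemma curve_degree_component i : curve_degree (C i) = rk i.
Proof. exact/curve_degree_linear/hilb_component. Qed.

(** Each new curve meets the old union in a point, which saves one dimension
    in the span and one condition in the Hilbert function. *)
Lemma connected_union_bounds J : connected_union J ->
  (\dim (linspan (subcurve J)) <= (\sum_(i in J) rk i).+1)%N /\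
  forall t, (hilb (subcurve J) t <= (\sum_(i in J) rk i) * t + 1)%N.
Proof.
elim=> [i|i j {}J cJ [IHd IHh] iJ jJ mij].
  by rewrite big_set1 subcurve1 dim_linspan; split=> // t; rewrite hilb_component.
rewrite (big_setU1 _ jJ) /=; split=> [|t].
  by apply: leq_trans (dim_linspan_glue iJ mij) _; rewrite -addnS leq_add2l.
have [P CiP CjP] := mij; rewrite subcurveU1.
have := @hilb_union _ _ (C j) (subcurve J) t P CjP (subcurve_sub iJ CiP).
have := IHh t; rewrite hilb_component mulnDl => le lt.
move: le lt; move: ((\sum_(i in J) rk i) * t)%N (hilb _ _) (hilb _ _) => q x y.
lia.
Qed.

(** The spans of the two curves together have dimension at least
    rk i + rk j + 1, which is attained only if they share no more than a point. *)
Lemma linspan_adjacent i j : i != j -> adjacent i j ->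
  (\dim (linspan (C i) :&: linspan (C j)) <= 1)%N.
Proof.
move=> ij mij; have s0 : (0 < s)%N := leq_ltn_trans (leq0n i) (ltn_ord i).
have := @dim_linspan_lower (j |: [set i])%SET; rewrite subcurveU1 subcurve1 linspanU => /(_ _)-h.
have {}h : (n < \dim (linspan (C j) + linspan (C i)) +
    \sum_(k in ~: (j |: [set i])) rk k)%N.
  by apply: h; apply/negP => /eqP /setP /(_ i); rewrite !inE eqxx orbT.
have := dimv_sum_cap (linspan (C j)) (linspan (C i)).
have nE : n = (rk i + (rk j + \sum_(k in ~: (j |: [set i])) rk k))%N.
  rewrite -(sum_rk s0) (bigD1 i) //= (bigD1 j) /=; last by rewrite eq_sym.
  congr (_ + (_ + _))%N; apply: eq_bigl => k; by rewrite !inE negb_or andbC.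
rewrite capvC !dim_linspan; lia.
Qed.

(** The two tangent spaces have dimension at least 2 and lie in the spans of
    the curves, which share only a line of the affine cone; so their sum has
    dimension at least 3. *)
Lemma singular_meet i j P : i != j -> C i P -> C j P -> ~ smooth_locus T P.
Proof.
move=> ij CiP CjP /smooth_locusP [_ d2].
have CT k : C k `<=` T by apply: subcurve_sub; rewrite inE.
have sub : (\dim (tangent (C i) P + tangent (C j) P) <= 2)%N.
  by rewrite -d2 dimvS // subv_add !tangentS.
have cap : (\dim (tangent (C i) P :&: tangent (C j) P) <= 1)%N.
  apply: leq_trans (linspan_adjacent ij _); last by exists P.
  by apply/dimvS/capvS; exact: tangent_linspan.
have := dimv_sum_cap (tangent (C i) P) (tangent (C j) P).
have := tangent_ge2 (irrC i) (ntC i) CiP; have := tangent_ge2 (irrC j) (ntC j) CjP.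
lia.
Qed.

(** Near P the curve is C i, a curve of degree rk i in a space of dimension
    rk i. *)
Lemma smooth_of_unique i P : C i P -> (forall j, C j P -> j = i) -> smooth_locus T P.
Proof.
move=> CiP uniq; pose B := subcurve (~: [set i])%SET.
have TE : T = C i `|` B.
  rewrite -subcurveU1; congr subcurve; apply/setP => k; rewrite !inE.
  by case: (k == i).
apply/smooth_locusP; split; first by rewrite TE; left.
have [d [G [hG GB GP]]] : exists d G, [/\ G \is d.-homog, vanishing_ideal B G & G.@[rep P 0] != 0].
  apply: closed_sep; last by case=> j; rewrite !inE => /negP ji /uniq /eqP.
  by rewrite /B -subcurve_big; apply: closed_bigU => j _.
rewrite TE (tangent_local CiP GB GP); apply/eqP.
rewrite eqn_leq tangent_ge2 // andbT.
have [c [t1 h]] := hilb_component_bound i.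
exact: tangent_le2 (irrC i) (ntC i) (dim_linspan i) h CiP.
Qed.

Section Terracini.
Variables (d : nat) (S : {fset psp}).
Hypotheses (n1 : (1 < n)%N) (d0 : (0 < d)%N)
  (minS : minimally_terracini d (1 + uphalf (n * d))%N S)
  (ST : [set` S] `<=` T).

Definition trace J : {fset psp} := [fset P in S | `[< subcurve J P >]]%fset.

Lemma mem_trace J P : P \in trace J = (P \in S) && `[< subcurve J P >].
Proof. by rewrite !inE. Qed.

(** The union of the curves in J spans a proper subspace, so its trace on S is
    a proper subset of S and minimality applies. *)
Lemma card_trace J : connected_union J -> J != [set: 'I_s]%SET ->
  (2 * #|` trace J| <= (\sum_(i in J) rk i) * d + 1)%N.
Proof.
move=> cJ JT; have [bd bh] := connected_union_bounds cJ.
have [[_ _ _ spS] minA] := minS.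
have [k kJ] : exists k, k \notin J.
  apply/existsP; rewrite -negb_forall; apply: contra JT => /forallP h.
  by apply/eqP/setP => k; rewrite h inE.
have s0 : (0 < s)%N := leq_ltn_trans (leq0n k) (ltn_ord k).
have ltJ : (\sum_(i in J) rk i < n)%N.
  rewrite -(sum_rk s0) [ltnRHS](bigID (mem J)) /= -[ltnLHS]addn0 ltn_add2l.
  by rewrite (bigD1 k) //= ltn_addr // rk_gt0.
have proper : (trace J `<` S)%fset.
  rewrite fproperE; apply/andP; split.
    by apply/fsubsetP => P; rewrite mem_trace => /andP [].
  apply/negP => /fsubsetP h; suff E : linspan (subcurve J) = fullv.
    by move: bd; rewrite E dimvf /dim /= mul1n ltnS leqNgt ltJ.
  apply: spS => P /h; rewrite mem_trace => /andP [_ /asboolP].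
  exact: linspan_sub.
apply: leq_trans (bh d); apply: hilb_double_points => //; first exact: ltnW.
- exact: minA.
- by move=> P /=; rewrite mem_trace => /andP [_ /asboolP].
move=> P; rewrite mem_trace => /andP [_ /asboolP [i iJ CiP]].
apply: leq_trans (tangent_ge2 (irrC i) (ntC i) CiP) _.
by apply/dimvS/tangentS/subcurve_sub.
Qed.

(** The two bounds of [card_trace] add up to n d + 2, which is at most 2 #S; so
    both are equalities, and no point of S is counted twice. *)
Lemma terracini_split J : connected_union J -> connected_union (~: J)%SET ->
  [/\ ~~ odd n, odd d, odd (\sum_(i in J) rk i)%N,
      (2 * #|` trace J| = (\sum_(i in J) rk i) * d + 1)%N
    & forall P, P \in S -> subcurve J P -> ~ subcurve (~: J)%SET P].
Proof.
move=> cJ cJ'.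
have ne X : connected_union X -> exists i, i \in X.
  by case=> [i|i j X' _ _ _ _]; [exists i | exists j]; rewrite !inE eqxx.
have [i iJ] := ne _ cJ; have [j jJ'] := ne _ cJ'.
have s0 : (0 < s)%N := leq_ltn_trans (leq0n i) (ltn_ord i).
have JT : J != [set: 'I_s]%SET.
  by apply: contraTneq jJ' => ->; rewrite !inE.
have J'T : (~: J)%SET != [set: 'I_s]%SET.
  by apply/negP => /eqP /setP /(_ i); rewrite !inE iJ.
have := card_trace cJ JT; have := card_trace cJ' J'T.
have [[cS _ _ _] _] := minS.
have := cardfsUI (trace J) (trace (~: J)%SET).
have -> : (trace J `|` trace (~: J)%SET)%fset = S.
  apply/fsetP => P; rewrite in_fsetU !mem_trace -andb_orr.
  have [PS|//] := boolP (P \in S); have [k _ CkP] := ST PS.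
  by have [kJ|kJ] := boolP (k \in J); apply/orP; [left|right]; apply/asboolP;
    exists k; rewrite ?inE.
have nE : n = (\sum_(i in J) rk i + \sum_(i in ~: J) rk i)%N.
  rewrite -(sum_rk s0) (bigID (mem J)) /=; congr (_ + _)%N.
  by apply: eq_bigl => k; rewrite inE.
set a := (\sum_(i in J) rk i)%N in nE *; set b := (\sum_(i in ~: J) rk i)%N in nE *.
rewrite cS => cUI hb ha.
have eqnd : (n * d = a * d + b * d)%N by rewrite -mulnDl -nE.
have I0 : #|` trace J `&` trace (~: J)%SET|%fset = 0%N.
  move: cUI hb ha; rewrite uphalf_half; have := odd_double_half (n * d); lia.
have ea : (2 * #|` trace J| = a * d + 1)%N.
  move: cUI hb ha; rewrite uphalf_half; have := odd_double_half (n * d); lia.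
have eb : (2 * #|` trace (~: J)%SET| = b * d + 1)%N.
  move: cUI hb ha; rewrite uphalf_half; have := odd_double_half (n * d); lia.
have oddp x y : (2 * x = y + 1)%N -> odd y.
  by move=> E; have := congr1 odd E; rewrite mul2n odd_double addn1 /= => /esym /negbFE.
have /andP [oa od] : odd a && odd d by rewrite -oddM; exact: oddp ea.
have /andP [ob _] : odd b && odd d by rewrite -oddM; exact: oddp eb.
split=> //; first by rewrite nE oddD oa ob.
move=> P PS JP J'P; have /fsetP /(_ P) := cardfs0_eq I0.
by rewrite in_fsetI !mem_trace PS /= !asboolT.
Qed.

End Terracini.
End Configuration.

(** * Components of a reducible curve *)

Lemma krull1_two_points (K : closedFieldType) (n : nat) (C : set (pspace K n)) :
  krull_dim C 1 -> two_points C.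
Proof.
move=> [[Z [hZ chain]] _].
have [_ [[P ZP] _] _] := hZ 0%N isT; have [_ _ Z1C] := hZ 1%N isT.
have [Z01 nZ] := chain 0%N isT.
have [Q ZQ nQ] : exists2 Q, Z 1%N Q & ~ Z 0%N Q.
  by apply: contrapT => h; apply: nZ => Q ZQ; apply: contrapT => nq; apply: h; exists Q.
exists P, Q; split; [exact/Z1C/Z01 | exact: Z1C |].
by apply: contra_notN nQ => /eqP <-.
Qed.

Section Components.
Variables (K : closedFieldType) (n s : nat) (T : set (pspace K n)).
Variables (Tc : 'I_s -> set (pspace K n)).
Hypotheses (closedT : zariski_closed T) (hTc : components_are T Tc).

Lemma component_irr i : irreducible_component T (Tc i).
Proof. by apply/(hTc.2 _); exists i. Qed.

Lemma component_union : subcurve Tc [set: 'I_s]%SET = T.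
Proof.
apply/seteqP; split=> P.
  by case=> i _; have [_ h _] := component_irr i; exact: h.
by move=> /component_cover [C /(hTc.2 C) [i ->] CP]; exists i; rewrite ?inE.
Qed.

Lemma component_incomparable i j : i != j -> ~ Tc i `<=` Tc j.
Proof.
move=> /eqP ij sub; apply: ij; apply: hTc.1.
have [_ _ mx] := component_irr i; have [irr CT _] := component_irr j.
by rewrite (mx _ irr CT sub).
Qed.

(** The unions over J and over its complement are closed and cover T. *)
Lemma component_connected : zariski_connected T -> connected_config Tc.
Proof.
move=> [_ conn] J J0 JT; apply: contrapT => h.
have cl i : zariski_closed (Tc i) := component_closed closedT (component_irr i).
have clJ X : zariski_closed (subcurve Tc X).
  by rewrite -subcurve_big; apply: closed_bigU.
have sub X : T `<=` subcurve Tc X -> forall k, k \notin X -> False.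
  move=> TX k; apply/negP; rewrite negbK.
  have [irr CT _] := component_irr k.
  have [||i iX ki] := @irr_subU _ _ (Tc k) _ (mem X) Tc irr.
  - by move=> i _.
  - by rewrite subcurve_big => P /CT /TX.
  by have [->//|ne] := eqVneq k i; case: (component_incomparable ne ki).
have [||TJ|TJ] := conn _ _ (clJ J) (clJ (~: J)%SET).
- move=> P; rewrite -component_union => -[i _ CP].
  by have [iJ|iJ] := boolP (i \in J); [left|right]; exists i; rewrite ?inE.
- apply/seteqP; split=> // P [[_ [i iJ CiP]] [j]]; rewrite inE => jJ CjP.
  by apply: h; exists i, j; split=> //; exists P.
- have [k kJ] : exists k, k \notin J.
    apply/existsP; rewrite -negb_forall; apply: contra JT => /forallP hJ.
    by apply/eqP/setP => k; rewrite hJ inE.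
  exact: (sub J TJ k).
have [k kJ] := set0Pn _ J0.
by apply: (sub _ TJ k); rewrite inE negbK.
Qed.

End Components.

(** * The theorem *)

Theorem proposition4p7 (K : closedFieldType) (charK : [pchar K] =i pred0)
    (n d : nat) (hn : (2 <= n)%N) (hd : (5 <= d)%N)
    (T : set (pspace K n)) (hT : reducible_rnc T)
    (s : nat) (hs : (2 <= s)%N) (Tc : 'I_s -> set (pspace K n))
    (hTc : components_are T Tc)
    (S : {fset pspace K n})
    (hS : minimally_terracini d (1 + uphalf (n * d))%N S)
    (hST : [set` S] `<=` T) :
  [/\ [set` S] `<=` smooth_locus T,
      ~~ odd n /\ odd d
    & forall i : 'I_s, final_component T (Tc i) ->
        odd (curve_degree (Tc i)) /\
        (2 * card_on S (Tc i) = curve_degree (Tc i) * d + 1)%N].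
Proof.
have [[clT dimT] connT _ degT spT] := hT.
have TE := component_union hTc.
have irr i : zariski_irreducible (Tc i) by have [] := component_irr hTc i.
have cl i : zariski_closed (Tc i) := component_closed clT (component_irr hTc i).
have nt i : two_points (Tc i) := krull1_two_points (dimT _ (component_irr hTc i)).
have inc := component_incomparable hTc.
have conn := component_connected clT hTc connT.
have [c [t0 hilbT]] := curve_degree_bound degT (ltnW hn).
have spanT := linspan_spans spT.
rewrite -TE in spanT hilbT hST.
have d0 : (0 < d)%N by exact: leq_trans hd.
have split J cJ cJ' := @terracini_split K n s Tc irr cl nt inc conn c t0 spanT hilbT
  d S hn d0 hS hST J cJ cJ'.
pose i0 : 'I_s := Ordinal (ltnW hs).
have [i [j [ij mij]]] : exists i j : 'I_s, i != j /\ adjacent Tc i j.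
  have [||i [j [iJ jJ mij]]] := conn [set i0]%SET.
  - by apply/negP => /eqP /setP /(_ i0); rewrite !inE eqxx.
  - apply/negP => /eqP /setP /(_ (Ordinal hs)); rewrite !inE.
    by rewrite -val_eqE.
  by exists i, j; split=> //; apply: contraNneq jJ => <-.
split.
- move=> P PS; have [i' _ CP] := hST P PS.
  rewrite -TE; apply: (smooth_of_unique irr cl nt inc conn spanT hilbT CP) => k CkP.
  apply: contrapT => /eqP ki.
  have mki : adjacent Tc k i' by exists P.
  have [J [cJ cJ' kJ iJ]] := connected_split conn ki mki.
  have [_ _ _ _ h] := split J cJ cJ'.
  apply: (h P PS); [by exists k | by exists i'; rewrite ?inE].
- have [J [cJ cJ' _ _]] := connected_split conn ij mij.
  by have [? ? _ _ _] := split J cJ cJ'.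
move=> k [_ [P [[CkP sP] uniqP]]].
rewrite (curve_degree_component irr cl nt inc conn spanT hilbT).
have cJ' : connected_union Tc (~: [set k])%SET.
  apply: (@connected_complement _ _ _ _ k P conn).
    by have [->|ne] := eqVneq k i; [exists j; rewrite eq_sym | exists i; rewrite eq_sym].
  move=> l Q lk CkQ ClQ; apply/esym/uniqP; split=> //; split.
    by rewrite -TE; exists k; rewrite ?inE.
  rewrite -TE; apply: (singular_meet irr cl nt inc conn spanT hilbT lk ClQ CkQ).
have [_ _ ok ek _] := split _ (connected1 Tc k) cJ'.
move: ok ek; rewrite big_set1 => ok <-; split=> //.
by rewrite /card_on /trace subcurve1.
Qed.
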